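(* Let $\mathbb{P}$ be a joint distribution of a random vector $X_V=(X_i:i\in V)$, with $V$ finite, that is restricted-faithful to a DMAG $G^*$ with vertex set $V$. Let $\mathcal{P}(V)$ be the set of all posets with ground set $V$. If $$\tau\in\arg\min_{\pi\in\mathcal{P}(V)}|G_\pi| ,$$ then $G_\tau$ is Markov equivalent to $G^*$, i.e. $\mathcal{I}(G_\tau)=\mathcal{I}(G^* )$.
   Context: Graphs $G=(V,D,B)$ have a finite vertex set $V$, directed edges $D$ ($\rightarrow$) and bidirected edges $B$ ($\leftrightarrow$); $|G|:=|D|+|B|$; $\mathrm{skel}(G)$ is the undirected graph obtained by replacing every edge by an undirected edge. A path is a sequence of distinct vertices, consecutive ones being adjacent; it is directed if all its edges are directed toward later vertices. $\mathrm{an}_G(j)$ is the set of vertices with a directed path to $j$, including $j$ itself. An interior vertex of a path is a collider on the path if both path edges at it have an arrowhead at it (i.e. each is either directed into it or bidirected); otherwise it is a non-collider. $G$ is a directed ancestral graph if it has no directed cycles and whenever $i\leftrightarrow j$ there is no directed path from $i$ to $j$. For $S\subseteq V\setminus\{i,j\}$, distinct vertices $i$ and $j$ are m-connected given $S$ if there is a path between them on which every non-collider is not in $S$ and every collider is in $S$ or has a descendant (via a directed path) in $S$; otherwise they are m-separated given $S$. For disjoint sets, $A\perp\!\!\!\perp_G B\mid C$ means every $a\in A$ and $b\in B$ are m-separated given $C$. $\mathcal{I}(G)$ is the set of all m-separation relations of $G$. $G$ is maximal if every non-adjacent pair $i,j$ is m-separated given some $S\subseteq V\setminus\{i,j\}$.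 A DMAG is a maximal directed ancestral graph. For a directed ancestral graph $G$, $\overline{G}$ denotes the unique maximal directed ancestral supergraph of $G$ on the same vertex set with the same m-separation relations (it exists, by Richardson and Spirtes, and is obtained from $G$ by adding only bidirected edges). $\mathbb{P}$ is Markov to $G$ ($G$ is an IMAP of $\mathbb{P}$) if $A\perp\!\!\!\perp_G B\mid C$ implies $X_A\perp\!\!\!\perp_{\mathbb{P}}X_B\mid X_C$ for all disjoint $A,B,C\subseteq V$. A path $\langle i,\dots,k,j\rangle$ between non-adjacent $i$ and $j$ is discriminating (for $k$) if every vertex between $i$ and $k$ on it is both a collider on the path and a parent of $j$, and there is at least one vertex between $i$ and $k$. $\mathbb{P}$ is restricted-faithful to a DMAG $G=(V,D,B)$ if it is Markov to $G$ and: (1) if $(i,j)\in B\cup D$, then $X_i\not\perp\!\!\!\perp_{\mathbb{P}}X_j\mid X_S$ for every $S\subseteq V\setminus\{i,j\}$; (2) if $i-k-j$ is contained in $\mathrm{skel}(G)$ and $i$ is m-connected to $j$ in $G$ given $S\subseteq V\setminus\{i,j\}$, then $X_i\not\perp\!\!\!\perp_{\mathbb{P}}X_j\mid X_S$; (3) if $\langle i,\dots,k,j\rangle$ is a discriminating path in $G$ and $i$ is m-connected to $j$ in $G$ given $S\subseteq V\setminus\{i,j\}$, then $X_i\not\perp\!\!\!\perp_{\mathbb{P}}X_j\mid X_S$. For a poset $\pi=(V,\le_\pi)$, write $i\not\lessgtr_\pi j$ if $i,j$ are incomparable, and $\mathrm{pre}_\pi(i,j):=\{x\in V: x\le_\pi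 i\text{ or }x\le_\pi j\}$. For a directed ancestral graph $G$, $\mathrm{po}(G)$ is the poset $(V,\le_G)$ with $i\le_G j\iff i\in\mathrm{an}_G(j)$. $AG(\pi,\mathbb{P})$ is the directed ancestral graph on $V$ with directed edges $\{i\rightarrow j: i\neq j,\ i\le_\pi j,\ X_i\not\perp\!\!\!\perp_{\mathbb{P}}X_j\mid X_{\mathrm{pre}_\pi(i,j)\setminus\{i,j\}}\}$ and bidirected edges $\{i\leftrightarrow j: i\not\lessgtr_\pi j,\ X_i\not\perp\!\!\!\perp_{\mathbb{P}}X_j\mid X_{\mathrm{pre}_\pi(i,j)\setminus\{i,j\}}\}$. Finally $$G_\pi:=\overline{AG(\mathrm{po}(AG(\pi,\mathbb{P})),\mathbb{P})}.$$ *)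

(* Defs.v *)
From HB Require Import structures.
From mathcomp Require Import all_boot all_order all_algebra.
From mathcomp Require Import all_classical all_reals all_analysis.

Set Implicit Arguments.
Unset Strict Implicit.
Unset Printing Implicit Defensive.

Local Open Scope ring_scope.

(** ** Mixed graphs *)

(* A bidirected edge i <-> j is the unordered pair [set i; j], so that it is
   symmetric by construction and #|bid G| counts it once. *)
Record mgraph (V : finType) := MGraph {
  dir : {set V * V};
  bid : {set {set V}};
  dir_irr : [forall i, (i, i) \notin dir];
  bid_card2 : [forall e in bid, #|e : {set V}| == 2%N]
}.

Section Graphs.
Variable V : finType.
Implicit Types (G H : mgraph V) (i j k : V) (A B C S : {set V}) (p q : seq V).

Definition dedge G : rel V := fun i j => (i, j) \in dir G.
Definition bedge G : rel V := fun i j => [set i; j] \in bid G.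

(* Adjacency, i.e. the edge relation of skel(G). *)
Definition adj G : rel V := fun i j => [|| dedge G i j, dedge G j i | bedge G i j].

Definition gsize G : nat := (#|dir G| + #|bid G|)%N.

(* [connect] is reflexive, so j \in an G j. *)
Definition an G j : {set V} := [set i | connect (dedge G) i j].

Definition ancestral G : Prop :=
  (forall c, c != [::] -> ~~ cycle (dedge G) c) /\
  (forall i j, bedge G i j -> ~~ connect (dedge G) i j).

(* The edge between a and k has an arrowhead at k.  A path is recorded by its
   vertices only, which is unambiguous in an ancestral graph, where two vertices
   are joined by at most one edge. *)
Definition into G a k : bool := dedge G a k || bedge G a k.

Definition collider G a k b : bool := into G a k && into G b k.

(* p lists the vertices of a path from i to j, both endpoints included. *)
Definition path_between G i j p : bool :=
  if p is x :: q then [&& x == i, last x q == j, path (adj G) x q & uniq p]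
  else false.

(* [infix [:: a; k; b] p] says that a, k, b are consecutive on p, so that k
   ranges over the interior vertices of p. *)
Definition m_connecting G S p : Prop :=
  forall a k b, infix [:: a; k; b] p ->
    if collider G a k b then exists2 s, s \in S & k \in an G s
    else k \notin S.

Definition m_connected G S i j : Prop :=
  exists2 p, path_between G i j p & m_connecting G S p.

Definition m_separated G A B C : Prop :=
  forall a b, a \in A -> b \in B -> ~ m_connected G C a b.

Definition pairwise_disjoint A B C : bool :=
  [&& [disjoint A & B], [disjoint A & C] & [disjoint B & C]].

(* I(G), the triple (A, B, C) standing for the relation A _||_ B | C. *)
Definition msep_model G : set ({set V} * {set V} * {set V}) :=
  [set t | pairwise_disjoint t.1.1 t.1.2 t.2 /\
           m_separated G t.1.1 t.1.2 t.2]%classic.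

Definition maximal G : Prop :=
  forall i j, i != j -> ~~ adj G i j ->
    exists2 S : {set V}, S \subset ~: [set i; j] & ~ m_connected G S i j.

Definition dmag G : Prop := ancestral G /\ maximal G.

Definition is_maximal_completion G H : Prop :=
  [/\ dmag H, dir G \subset dir H, bid G \subset bid H &
      msep_model H = msep_model G].

(* Every directed ancestral G has exactly one maximal completion (Richardson and
   Spirtes, Ancestral graph Markov models, Ann. Statist. 2002), hence the default
   value G is only taken on graphs that are not ancestral. *)
Definition maximal_completion G : mgraph V :=
  if pselect (exists H, is_maximal_completion G H) is left e
  then projT1 (cid e) else G.

(* <i, q, k, j> is discriminating for k. *)
Definition discriminating G i q k j : Prop :=
  let p := i :: q ++ [:: k; j] in
  [/\ path_between G i j p, ~~ adj G i j, q != [::] &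
      forall v, v \in q -> dedge G v j /\
        (forall a b, infix [:: a; v; b] p -> collider G a v b)].

Definition is_poset (le : rel V) : Prop :=
  [/\ reflexive le, antisymmetric le & transitive le].

Definition incomparable (le : rel V) : rel V :=
  fun i j => ~~ le i j && ~~ le j i.

Definition pre (le : rel V) i j : {set V} := [set x | le x i || le x j].

Definition po G : rel V := fun i j => i \in an G j.

End Graphs.

(** ** Conditional independence *)

Section CondIndep.
Context {d : measure_display} {T : measurableType d} {R : realType}.
Variable P : probability T R.

(* f is a version of the conditional probability of E given the sigma-algebra
   generated by F. *)
Definition is_cond_prob (F : set (set T)) (E : set T) (f : T -> R) : Prop :=
  [/\ measurable_fun [set: g_sigma_algebraType F]%classic
        (f : g_sigma_algebraType F -> R),
      P.-integrable [set: T]%classic (EFin \o f) &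
      forall D : set T, (<<s F >>)%classic D ->
        (\int[P]_(t in D) (f t)%:E = P (E `&` D)%classic)%E].

Variables (V : finType) (X : V -> {RV P >-> R}).

(* sigma(X_A) is the sigma-algebra generated by this family. *)
Definition events_of (A : {set V}) : set (set T) :=
  fun E => exists2 i, i \in A & exists2 U : set R, measurable U &
    E = (X i @^-1` U)%classic.

(* P(E n F | X_C) = P(E | X_C) P(F | X_C) almost surely for all E in sigma(X_A)
   and F in sigma(X_B). *)
Definition cond_indep (A B C : {set V}) : Prop :=
  forall E F : set T,
    (<<s events_of A >>)%classic E -> (<<s events_of B >>)%classic F ->
  forall e f g : T -> R,
    is_cond_prob (events_of C) E e -> is_cond_prob (events_of C) F f ->
    is_cond_prob (events_of C) (E `&` F)%classic g ->
    {ae P, forall t, g t = e t * f t}.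

Definition dependent (i j : V) (S : {set V}) : Prop :=
  ~ cond_indep [set i] [set j] S.

Definition Markov (G : mgraph V) : Prop :=
  forall A B C, pairwise_disjoint A B C -> m_separated G A B C ->
    cond_indep A B C.

Definition restricted_faithful (G : mgraph V) : Prop :=
  [/\ Markov G,
      forall i j, adj G i j ->
        forall S : {set V}, S \subset ~: [set i; j] -> dependent i j S,
      forall i k j, i != j -> adj G i k -> adj G k j ->
        forall S : {set V}, S \subset ~: [set i; j] -> m_connected G S i j ->
          dependent i j S &
      forall i q k j, discriminating G i q k j ->
        forall S : {set V}, S \subset ~: [set i; j] -> m_connected G S i j ->
          dependent i j S].

Section AG.
Variable le : rel V.

Definition AG_dep (i j : V) : bool :=
  `[< dependent i j (pre le i j :\: [set i; j]) >].

Definition AG_dir : {set V * V} :=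
  [set e | [&& e.1 != e.2, le e.1 e.2 & AG_dep e.1 e.2]].

(* The condition i != j is implied by incomparability when le is a poset. *)
Definition AG_bid : {set {set V}} :=
  [set e | [exists i, exists j, [&& e == [set i; j], i != j,
     incomparable le i j & AG_dep i j]]].

Fact AG_dir_irr : [forall i, (i, i) \notin AG_dir].
Proof. by apply/forallP => i; rewrite inE eqxx. Qed.

Fact AG_bid_card2 : [forall e in AG_bid, #|e : {set V}| == 2%N].
Proof.
apply/forall_inP => e; rewrite inE => /existsP[i /existsP[j]].
by case/and4P => /eqP-> nij _ _; rewrite cards2 nij.
Qed.

Definition AG : mgraph V := MGraph AG_dir_irr AG_bid_card2.

End AG.

Definition Gpi (pi : rel V) : mgraph V := maximal_completion (AG (po (AG pi))).

End CondIndep.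

(* Main.v *)
Require Import Defs.
From HB Require Import structures.
From mathcomp Require Import all_boot all_order all_algebra.
From mathcomp Require Import all_classical all_reals all_analysis.
From mathcomp Require Import zify.

(* Let A = AG(po(AG(tau)), P).  Adjacent vertices of Gstar stay adjacent in every
   AG(pi, P), and AG(po(Gstar), P) = Gstar, so minimality of G_tau forces A to be
   maximal with the skeleton of Gstar.  By restricted faithfulness, vertices i, j at
   distance two that are not adjacent in A are m-separated in Gstar given pre(i, j)
   minus {i, j}.

   Given an m-connecting walk of minimal total number of descendants, every
   interior vertex k is the last interior vertex of a path <i, q, k, j>, along the
   walk except possibly for j, where i and j are not adjacent and the vertices of q
   are colliders, parents of j and members of the conditioning set (an unshielded
   triple if q is empty, a discriminating path otherwise).  A set S separating i
   from j then contains q, and contains k iff k is a non-collider.  Thus two graphs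
   with the same skeleton and a common separating set for every such pair (i, j)
   agree on the colliders of the walk, hence on m-connection.

   For A and Gstar the common separating set is the set of ancestors of i and j in
   A, provided that the order po(AG(tau)) is the ancestor relation of A.  This is
   the case: for an extra edge a -> b of AG(tau), the set W of predecessors of b is
   ancestral in A, and the same analysis of a minimal walk of Gstar from a to b
   given W minus {a, b} is contradictory. *)

Set Implicit Arguments.
Unset Strict Implicit.
Unset Printing Implicit Defensive.

(* lia case-splits on every boolean hypothesis, so only the arithmetic ones are kept. *)
Ltac nlia :=
  repeat match goal with H : ?T |- _ =>
    lazymatch T with
    | nat => fail
    | is_true (leq _ _) => fail
    | is_true (leq _ _ && leq _ _) => fail
    | @eq nat _ _ => fail
    | leq _ _ = false => fail
    | is_true (~~ (@eq_op _ ?a _)) => let A := type of a in unify A nat; fail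
    | _ => clear H
    end
  end; lia.

(** * Ancestral graphs and walks *)

Section AncestralGraphs.
Variable V : finType.
Implicit Types (G H : mgraph V) (i j k a b c x y : V) (C S Z : {set V}).

Lemma dedge_irr G a : dedge G a a = false.
Proof. by apply: negbTE; apply: (forallP (dir_irr G)). Qed.

Lemma bedge_irr G a : bedge G a a = false.
Proof.
apply/negbTE/negP => h; have /forall_inP/(_ _ h) := bid_card2 G.
by rewrite cards2 eqxx.
Qed.

Lemma bedge_sym G : symmetric (bedge G).
Proof. by move=> a b; rewrite /bedge finset.setUC. Qed.

Lemma adj_irr G a : adj G a a = false.
Proof. by rewrite /adj dedge_irr bedge_irr. Qed.

Lemma adj_neq G a b : adj G a b -> a != b.
Proof. by apply: contraTneq => ->; rewrite adj_irr. Qed.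

Lemma adj_sym G : symmetric (adj G).
Proof. by move=> a b; rewrite /adj bedge_sym orbCA. Qed.

Lemma collider_sym G a k b : collider G a k b = collider G b k a.
Proof. by rewrite /collider andbC. Qed.

Lemma dedge_adj G a b : dedge G a b -> adj G a b.
Proof. by rewrite /adj => ->. Qed.

Lemma bedge_adj G a b : bedge G a b -> adj G a b.
Proof. by rewrite /adj => ->; rewrite !orbT. Qed.

Lemma into_adj G a b : into G a b -> adj G a b.
Proof. by case/orP => [/dedge_adj|/bedge_adj]. Qed.

Lemma adj_into G a b : adj G a b -> into G a b || dedge G b a.
Proof. by rewrite /adj /into => /or3P[] ->; rewrite ?orbT. Qed.

Section Ancestral.
Variable G : mgraph V.
Hypothesis Ganc : ancestral G.

Lemma dedge_nconnect a b : dedge G a b -> ~~ connect (dedge G) b a.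
Proof.
move=> ab; apply/negP => /connectP[p hp la].
have := Ganc.1 (b :: p); rewrite /= rcons_path hp -la ab => /(_ isT).
by [].
Qed.

Lemma into_nconnect a b : into G a b -> ~~ connect (dedge G) b a.
Proof.
case/orP => [|ab]; first exact: dedge_nconnect.
by apply: Ganc.2; rewrite bedge_sym.
Qed.

Lemma connect_anti a b :
  connect (dedge G) a b -> connect (dedge G) b a -> a = b.
Proof.
case/connectP=> -[|c p] /= hp -> //; case/andP: hp => ac hp hb.
have := dedge_nconnect ac; case/negP; apply: connect_trans hb.
by apply/connectP; exists p.
Qed.

Lemma dedge_ninto a b : dedge G a b -> into G b a = false.
Proof. by move=> ab; apply/negP => /into_nconnect/negP[]; apply: connect1. Qed.

Lemma into_trans a b c :
  into G a b -> dedge G b c -> adj G a c -> into G a c.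
Proof.
move=> ab bc /adj_into/orP[//|ca]; have /negP[] := into_nconnect ab.
by apply: connect_trans (connect1 ca); apply: connect1.
Qed.

Lemma dedge_trans a b c :
  dedge G a b -> dedge G b c -> adj G a c -> dedge G a c.
Proof.
move=> ab bc; rewrite adj_sym => /adj_into/orP[ca|//].
have /negP[] := into_nconnect ca.
by apply: connect_trans (connect1 bc); apply: connect1.
Qed.

Lemma ncollider_out a k b : adj G a k -> adj G k b ->
  ~~ collider G a k b = dedge G k a || dedge G k b.
Proof.
move=> ak kb; rewrite /collider negb_and.
have E u : adj G u k -> ~~ into G u k = dedge G k u.
  move=> uk; case: (boolP (dedge G k u)) => [/dedge_ninto-> //|nd].
  by have := adj_into uk; rewrite (negbTE nd) orbF => ->.
by rewrite !E // adj_sym.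
Qed.

Lemma ninto_dedge a b : adj G a b -> ~~ into G a b -> dedge G b a.
Proof. by move/adj_into/orP => [->|]. Qed.

End Ancestral.

Definition anc G Z : {set V} :=
  [set k | [exists s in Z, connect (dedge G) k s]]%SET.

Lemma ancP G Z k :
  reflect (exists2 s, s \in Z & connect (dedge G) k s) (k \in anc G Z).
Proof. by rewrite inE; apply: exists_inP. Qed.

Lemma anc_self G Z k : k \in Z -> k \in anc G Z.
Proof. by move=> kZ; apply/ancP; exists k. Qed.

Lemma anc_connect G Z a b : connect (dedge G) a b -> b \in anc G Z -> a \in anc G Z.
Proof.
by move=> ab /ancP[s sZ bs]; apply/ancP; exists s => //; apply: connect_trans bs.
Qed.

Lemma anc_dedge G Z a b : dedge G a b -> b \in anc G Z -> a \in anc G Z.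
Proof. by move/connect1; apply: anc_connect. Qed.

Lemma ancU G Z Z' k : (k \in anc G (Z :|: Z')) = (k \in anc G Z) || (k \in anc G Z').
Proof.
apply/ancP/orP => [[s /setUP[sZ|sZ] ks]|].
- by left; apply/ancP; exists s.
- by right; apply/ancP; exists s.
case=> /ancP[s sZ ks]; exists s => //; rewrite inE sZ ?orbT //.
Qed.

Lemma anc2 G x y k : (k \in anc G [set x; y]) =
  connect (dedge G) k x || connect (dedge G) k y.
Proof.
apply/ancP/orP => [[s /set2P[]-> ks]|[ks|ks]]; first by left.
- by right.
- by exists x => //; rewrite set21.
- by exists y => //; rewrite set22.
Qed.

(* Walks may repeat vertices; a walk of length n visits v 0, ..., v n.  Colliders
   must lie in C, non-colliders outside S; m-connection given S is C = anc G S. *)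
Definition triple_ok G C S a k b : bool :=
  if collider G a k b then k \in C else k \notin S.

Lemma triple_ok_sym G C S a k b : triple_ok G C S a k b = triple_ok G C S b k a.
Proof. by rewrite /triple_ok collider_sym. Qed.

Definition walk G C S n (v : nat -> V) : Prop :=
  (forall t, t < n -> adj G (v t) (v t.+1)) /\
  (forall t, t.+1 < n -> triple_ok G C S (v t) (v t.+1) (v t.+2)).

(* reach G C S x h u: some walk from x ends in u, with an arrowhead at u iff h. *)
Inductive reach G C S x : bool -> V -> Prop :=
| reach_edge u : adj G x u -> reach G C S x (into G x u) u
| reach_step h u w : reach G C S x h u -> adj G u w ->
    (if h && into G w u then u \in C else u \notin S) ->
    reach G C S x (into G u w) w.

Lemma walk_reach G C S n v : walk G C S n.+1 v ->
  reach G C S (v 0) (into G (v n) (v n.+1)) (v n.+1).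
Proof.
elim: n => [|n IH] [vadj vok]; first by apply: reach_edge; apply: vadj.
apply: (reach_step (IH _) (vadj n.+1 _)) => //; last exact: (vok n).
by split=> t tn; [apply: vadj|apply: vok]; lia.
Qed.

Lemma reach_walk G C S x h y : reach G C S x h y ->
  exists n v, [/\ walk G C S n.+1 v, v 0 = x, v n.+1 = y & h = into G (v n) y].
Proof.
elim=> {h y} [u xu|h u w _ [n [v [[vadj vok] vx vu hE]]] uw ok].
  exists 0, (fun t => if t is 0 then x else u); split=> //; split=> // -[] //.
exists n.+1, (fun t => if t <= n.+1 then v t else w).
rewrite !leqnn !ltnn vu vx; split=> //; split=> t tn.
  have [->|tn'] := eqVneq t n.+1; first by rewrite leqnn ltnn vu.
  have -> : t <= n.+1 by lia.
  have -> : t < n.+1 by lia.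
  by apply: vadj; lia.
have [->|tn'] := eqVneq t n.
  by rewrite leqnn leqnSn ltnn vu /triple_ok /collider -hE.
have -> : t <= n.+1 by lia.
have -> : t < n.+1 by lia.
have -> : t.+1 < n.+1 by lia.
by apply: vok; lia.
Qed.

(** Each vertex of the directed path is left by an edge with its tail there, so it is a non-collider
    and only has to avoid [S]. *)
Lemma reach_down G C S x h u y : ancestral G ->
  connect (dedge G) u y -> reach G C S x h u ->
  (forall w, connect (dedge G) u w -> w != y -> w \notin S) ->
  exists h', reach G C S x h' y.
Proof.
move=> Ganc /connectP[p]; elim: p h u => [|w p IH] h u /=.
  by move=> _ -> ? _; exists h.
case/andP=> uw hp yE hu nS; apply: (IH _ w hp yE (reach_step hu (dedge_adj uw) _)).
  rewrite (dedge_ninto Ganc uw) andbF; apply: nS => //.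
  apply: contraNneq (dedge_nconnect Ganc uw) => ->; rewrite yE.
  by apply/connectP; exists p.
by move=> w' ww'; apply: nS; apply: connect_trans (connect1 uw) ww'.
Qed.

(** The directed path is run backwards. The value [false] records a tail at [u], so any continuation
    makes [u] a non-collider. *)
Lemma reach_up G C S x u : ancestral G ->
  connect (dedge G) u x -> u != x ->
  (forall w, connect (dedge G) u w -> w \notin S) ->
  reach G C S x false u.
Proof.
move=> Ganc /connectP[p]; elim: p u => [|w p IH] u /=.
  by move=> _ -> /eqP.
case/andP=> uw hp yE ux nS; have uwF := dedge_ninto Ganc uw.
have wu : adj G w u by rewrite adj_sym dedge_adj.
have [wx|wx] := eqVneq w x; first by rewrite -uwF wx; apply: reach_edge; rewrite -wx.
rewrite -uwF; apply: (reach_step (IH w hp yE wx _) wu).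
  by move=> w' ww'; apply: nS; apply: connect_trans (connect1 uw) ww'.
by rewrite /= nS ?connect1.
Qed.

(* A collider that is only an ancestor of an endpoint can be bypassed by a
   directed path to that endpoint. *)
Lemma reach_relax G S x y h u : ancestral G ->
  reach G (anc G (S :|: [set x; y])) S x h u ->
  reach G (anc G S) S x h u \/ exists h', reach G (anc G S) S x h' y.
Proof.
move=> Ganc; elim=> {h u} [u xu|h u w _ IH uw ok]; first by left; apply: reach_edge.
case: IH => [IH|]; last by right.
have [uS|uS] := boolP (u \in anc G S).
  left; apply: (reach_step IH uw); case: ifP ok => //.
have nS w' : connect (dedge G) u w' -> w' \notin S.
  by move=> uw'; apply: contra uS => /(anc_self G); apply: anc_connect.
move: ok; case: ifP => [_|hF uS']; last first.
  by left; apply: (reach_step IH uw); rewrite hF.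
rewrite ancU (negbTE uS) anc2 /= => /orP[ux|uy]; last first.
  right; have := reach_down Ganc uy IH; apply=> w' uw' _; exact: nS.
left; have [uxE|nux] := eqVneq u x.
  by rewrite uxE; apply: reach_edge; rewrite -uxE.
by apply: (reach_step (reach_up _ Ganc ux nux nS) uw); rewrite nS.
Qed.

End AncestralGraphs.

(** * Surgery on walks and walks of minimal weight *)

Section Walks.
Variables (V : finType) (G : mgraph V).
Implicit Types (i j k a b c x y : V) (C S Z : {set V}) (v w : nat -> V).

Lemma walk_prefix C S n v l : l <= n -> walk G C S n v -> walk G C S l v.
Proof. by move=> ln [vadj vok]; split=> t tl; [apply: vadj|apply: vok]; lia. Qed.

Lemma walk_suffix C S n v r : r <= n -> walk G C S n v ->
  walk G C S (n - r) (fun t => v (r + t)).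
Proof.
move=> rn [vadj vok]; split=> t tl; rewrite !addnS; first by apply: vadj; lia.
by apply: vok; lia.
Qed.

Lemma walk_rev C S n v : walk G C S n v -> walk G C S n (fun t => v (n - t)).
Proof.
move=> [vadj vok]; split=> t tn.
  rewrite adj_sym; have -> : n - t = (n - t.+1).+1 by lia.
  by apply: vadj; lia.
rewrite triple_ok_sym; have -> : n - t = (n - t.+2).+2 by lia.
have -> : n - t.+1 = (n - t.+2).+1 by lia.
by apply: vok; lia.
Qed.

Definition catw n v w t := if t <= n then v t else w (t - n.+1).

Lemma walk_cat C S n v m w : walk G C S n v -> walk G C S m w ->
  adj G (v n) (w 0) ->
  (0 < n -> triple_ok G C S (v n.-1) (v n) (w 0)) ->
  (0 < m -> triple_ok G C S (v n) (w 0) (w 1)) ->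
  walk G C S (n + m.+1) (catw n v w).
Proof.
move=> [vadj vok] [wadj wok] vw okv okw; rewrite /catw; split=> t tn.
  have [->|nt] := eqVneq t n; first by rewrite leqnn ltnn subnn.
  have [tn'|tn'] := leqP t n.
    have -> : t < n by lia.
    by apply: vadj; lia.
  have -> : (t < n) = false by lia.
  have -> : t.+1 - n.+1 = (t - n.+1).+1 by lia.
  by apply: wadj; lia.
have [tE|nt] := eqVneq t n.
  rewrite tE leqnn ltnn (_ : n.+2 <= n = false); last by lia.
  by rewrite subnn (_ : n.+2 - n.+1 = 1); [apply: okw; lia|lia].
have [tE|nt1] := eqVneq t.+1 n.
  rewrite -tE leqnn ltnn leqnSn subnn tE (_ : t = n.-1); last by lia.
  by apply: okv; lia.
have [tn'|tn'] := leqP t n.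
  have -> : t < n by lia.
  have -> : t.+1 < n by lia.
  by apply: vok; lia.
have -> : (t < n) = false by lia.
have -> : (t.+1 < n) = false by lia.
have -> : t.+2 - n.+1 = (t - n.+1).+2 by lia.
have -> : t.+1 - n.+1 = (t - n.+1).+1 by lia.
by apply: wok; lia.
Qed.

Definition weight (f : V -> nat) n v := \sum_(0 <= t < n.+1) f (v t).

Lemma weight_cat f n v m w :
  weight f (n + m.+1) (catw n v w) = weight f n v + weight f m w.
Proof.
rewrite /weight (@big_cat_nat _ _ _ n.+1) //=; last by lia.
congr (_ + _).
  by apply: eq_big_nat => t /andP[_ tn]; rewrite /catw -ltnS tn.
rewrite -[X in \sum_(X <= _ < _) _ = _]add0n big_addn (_ : _ - n.+1 = m.+1); last by lia.
apply: eq_big_nat => t _; rewrite /catw.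
by rewrite (_ : t + n.+1 <= n = false) ?addnK //; lia.
Qed.

Lemma weight_suffix f n v r : r <= n ->
  weight f (n - r) (fun t => v (r + t)) = \sum_(r <= t < n.+1) f (v t).
Proof.
move=> rn; rewrite /weight -[X in _ = \sum_(X <= _ < _) _]add0n big_addn subSn //.
by apply: eq_bigr => t _; rewrite addnC.
Qed.

Lemma weight_split f n v l r : l < r -> r <= n ->
  weight f n v = weight f l v + \sum_(l.+1 <= t < r) f (v t) +
    weight f (n - r) (fun t => v (r + t)).
Proof.
move=> lr rn; rewrite weight_suffix // /weight.
rewrite (@big_cat_nat _ _ _ l.+1) //=; last by lia.
rewrite (@big_cat_nat _ _ _ r l.+1) //=; last by lia.
by rewrite addnA.
Qed.

Lemma walk_splice C S n v l r : walk G C S n v -> l < r -> r <= n ->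
  adj G (v l) (v r) ->
  (0 < l -> triple_ok G C S (v l.-1) (v l) (v r)) ->
  (r < n -> triple_ok G C S (v l) (v r) (v r.+1)) ->
  walk G C S (l + (n - r).+1) (catw l v (fun t => v (r + t))).
Proof.
move=> vw lr rn vlr okl okr; apply: walk_cat; rewrite ?addn0 ?addn1 //.
- by apply: walk_prefix vw; lia.
- exact: walk_suffix vw.
- by move=> h; apply: okr; lia.
Qed.

Lemma catw_last n v m w : catw n v w (n + m.+1) = w m.
Proof.
rewrite /catw (_ : _ <= n = false); last by lia.
by congr w; lia.
Qed.

Notation mwalk Z := (walk G (anc G Z) Z).

Section MinimalWalks.
Hypothesis Ganc : ancestral G.

(** A walk that leaves [v s] along a directed edge keeps following directed edges until it meets a
    collider. That collider is in [anc G Z], and so is its ancestor [v s]. *)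
Lemma walk_follow Z n v s t : mwalk Z n v -> s < t <= n ->
  dedge G (v s) (v s.+1) ->
  v s \in anc G Z \/ (dedge G (v t.-1) (v t) /\ connect (dedge G) (v s.+1) (v t)).
Proof.
move=> [vadj vok] /andP[st tn] ss; case: (boolP (v s \in anc G Z)) => [|vs]; first by left.
right; elim: t st tn => // t IH; rewrite ltnS leq_eqVlt => /predU1P[<- _|st tn].
  by [].
have [||tt ct] := IH => //; first by lia.
suff tt1 : dedge G (v t) (v t.+1).
  by split=> //; apply: connect_trans (connect1 tt1).
have : triple_ok G (anc G Z) Z (v t.-1) (v t) (v t.+1).
  by have := vok t.-1; rewrite prednK; [apply; lia|lia].
rewrite /triple_ok; case: ifP => [_ vt|/negbT].
  case/negP: vs; apply: anc_dedge ss _; exact: anc_connect ct vt.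
rewrite (ncollider_out Ganc) ?(dedge_adj tt) //; last by apply: vadj; lia.
case/orP => // t1 _; have := dedge_ninto Ganc tt.
by rewrite /into t1.
Qed.

(** A non-collider has an outgoing edge on the walk; following it leads into [anc G Z] or to an
    endpoint. *)
Lemma walk_anc Z n v t : mwalk Z n v -> t <= n ->
  v t \in anc G (Z :|: [set v 0; v n]).
Proof.
move=> vw tn; have [vadj vok] := vw; rewrite ancU anc2.
have [->|t0] := posnP t; first by rewrite connect0 orbT.
have [->|tn'] := eqVneq t n; first by rewrite connect0 !orbT.
have fwd m w s : mwalk Z m w -> s < m -> dedge G (w s) (w s.+1) ->
    w s \in anc G Z \/ connect (dedge G) (w s) (w m).
  move=> ww sm ss; case: (walk_follow (t := m) ww _ ss); rewrite ?sm ?leqnn //.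
    by left.
  by case=> _ /(connect_trans (connect1 ss)); right.
have : triple_ok G (anc G Z) Z (v t.-1) (v t) (v t.+1).
  by have := vok t.-1; rewrite prednK //; apply; lia.
rewrite /triple_ok; case: ifP => [_ -> //|/negbT].
rewrite (ncollider_out Ganc); first last.
- by apply: vadj; lia.
- by have := vadj t.-1; rewrite prednK //; apply; lia.
case/orP => [tp _|tt _].
  have e1 : n - (n - t) = t by lia.
  have e2 : n - (n - t).+1 = t.-1 by lia.
  have nt : n - t < n by lia.
  have := fwd n _ (n - t) (walk_rev vw) nt.
  by rewrite e1 e2 subnn => /(_ tp)[->|->]; rewrite ?orbT.
by case: (fwd n v t) => // [|->|->]; rewrite ?orbT //; lia.
Qed.

(** The delicate case is a collider created from two non-colliders: the walk then leaves [v s] by a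
    directed edge, and following it back to [v t = v s] would close a directed cycle unless [v s] is
    in [anc G Z]. *)
Lemma walk_contract Z n v s t : mwalk Z n v -> s < t < n -> 0 < s ->
  v s = v t -> triple_ok G (anc G Z) Z (v s.-1) (v s) (v t.+1).
Proof.
move=> vw /andP[st tn] s0 vst; have [vadj vok] := vw.
have oks : triple_ok G (anc G Z) Z (v s.-1) (v s) (v s.+1).
  by have := vok s.-1; rewrite prednK //; apply; lia.
have okt : triple_ok G (anc G Z) Z (v t.-1) (v s) (v t.+1).
  by rewrite vst; have := vok t.-1; rewrite prednK; [apply; lia|lia].
have a1 : adj G (v s.-1) (v s).
  by have := vadj s.-1; rewrite prednK //; apply; lia.
have a2 : adj G (v s) (v s.+1) by apply: vadj; lia.
have a4 : adj G (v s) (v t.+1) by rewrite vst; apply: vadj; lia.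
have a3 : adj G (v t.-1) (v s).
  by rewrite vst; have := vadj t.-1; rewrite prednK; [apply; lia|lia].
move: oks okt; rewrite /triple_ok.
have [c1|c1] := boolP (collider G (v s.-1) (v s) (v s.+1)).
  move=> vsZ okt; case: ifPn => // cc; move: okt; case: ifP => // c2 _; case/negP: cc.
  by rewrite /collider; case/andP: c1 => ->; case/andP: c2.
move=> nsZ; have [c2|c2] := boolP (collider G (v t.-1) (v s) (v t.+1)).
  by case: ifP.
case: ifP => // /andP[i1 i2] _.
have {c1} d1 : dedge G (v s) (v s.+1).
  move: c1; rewrite ncollider_out // => /orP[/(dedge_ninto Ganc)|//].
  by rewrite i1.
have stn : s < t <= n by rewrite st ltnW.
have [//|[_]] := walk_follow vw stn d1.
by rewrite -vst (negbTE (dedge_nconnect Ganc d1)).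
Qed.

Definition minimal_walk f Z n v : Prop :=
  mwalk Z n v /\
  forall m w, mwalk Z m w -> w 0 = v 0 -> w m = v n -> weight f n v <= weight f m w.

Lemma minimal_walk_exists f Z n v : mwalk Z n v ->
  exists m w, [/\ minimal_walk f Z m w, w 0 = v 0 & w m = v n].
Proof.
move=> vw.
pose P q := `[< exists m w, [/\ mwalk Z m w, w 0 = v 0, w m = v n & weight f m w = q] >].
have exP : exists q, P q by exists (weight f n v); apply/asboolP; exists n, v.
case: (ex_minnP exP) => q /asboolP[m [w [ww w0 wm wq]]] qmin.
exists m, w; split=> //; split=> // m' w' ww' w0' wm'.
by rewrite wq; apply: qmin; apply/asboolP; exists m', w'; rewrite w0' wm'.
Qed.

Lemma minimal_walk_splice f Z n v l r : (forall u, 0 < f u) ->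
  minimal_walk f Z n v -> l.+1 < r -> r <= n -> adj G (v l) (v r) ->
  (0 < l -> triple_ok G (anc G Z) Z (v l.-1) (v l) (v r)) ->
  (r < n -> triple_ok G (anc G Z) Z (v l) (v r) (v r.+1)) -> False.
Proof.
move=> f0 [vw vmin] lr rn vlr okl okr.
have lr' : l < r by lia.
have := vmin _ _ (walk_splice vw lr' rn vlr okl okr) erefl.
rewrite catw_last subnKC // weight_cat => /(_ erefl).
rewrite (weight_split _ _ lr' rn) leq_add2r -{2}[weight f l v]addn0 leq_add2l leqn0.
rewrite big_ltn // addn_eq0 => /andP[/eqP fl _].
by have := f0 (v l.+1); rewrite fl.
Qed.

Lemma minimal_walk_inj f Z n v : (forall u, 0 < f u) -> minimal_walk f Z n v ->
  forall s t, s < t <= n -> v s != v t.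
Proof.
move=> f0 vm s t /andP[st]; have [vw vmin] := vm; have [vadj vok] := vw.
rewrite leq_eqVlt => /predU1P[tn|tn]; apply/eqP => vst.
  have sn : s < n by lia.
  have := vmin _ _ (walk_prefix (ltnW sn) vw) erefl.
  rewrite vst tn => /(_ erefl).
  rewrite (weight_split f v sn (leqnn n)) -addnA -{2}[weight f s v]addn0 leq_add2l.
  rewrite subnn /weight big_nat1 addn0 leqn0 addn_eq0 => /andP[_ /eqP fn].
  by have := f0 (v n); rewrite fn.
apply: (minimal_walk_splice f0 vm (l := s) (r := t.+1)) => //.
- by rewrite vst; apply: vadj.
- by move=> s0; apply: walk_contract vw _ _ _; rewrite ?st.
- by rewrite vst; apply: vok.
Qed.

End MinimalWalks.
End Walks.

(** * m-connection by walks, and inducing paths *)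

Section Connection.
Variables (V : finType) (G : mgraph V).
Implicit Types (i j k a b c x y : V) (C S Z : {set V}) (v w : nat -> V).

Notation mwalk Z := (walk G (anc G Z) Z).

Lemma infix3P (T : eqType) (x0 a k b : T) (p : seq T) :
  reflect (exists t, [/\ t.+2 < size p, nth x0 p t = a, nth x0 p t.+1 = k &
                         nth x0 p t.+2 = b])
          (infix [:: a; k; b] p).
Proof.
apply: (iffP (@infixP _ _ _)) => [[s1 [s2 ->]]|[t [tp <- <- <-]]].
  have nthE d : nth x0 (s1 ++ [:: a; k; b] ++ s2) (size s1 + d) =
                nth x0 ([:: a; k; b] ++ s2) d.
    by rewrite nth_cat ltnNge leq_addr /= addKn.
  have := nthE 2; have := nthE 1; have := nthE 0; rewrite addn0 addn1 addn2 => e0 e1 e2.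
  by exists (size s1); rewrite e0 e1 e2 !size_cat /=; split=> //; lia.
exists (take t p), (drop t.+3 p).
rewrite -[LHS](cat_take_drop t) (drop_nth x0); last by lia.
rewrite (drop_nth x0 (n := t.+1)); last by lia.
by rewrite (drop_nth x0 (n := t.+2)).
Qed.

Lemma m_connected_walk Z x y : m_connected G Z x y -> exists n v,
  [/\ mwalk Z n v, v 0 = x, v n = y & forall s t, s < t <= n -> v s != v t].
Proof.
case=> -[//|x' q] /and4P[/eqP-> /eqP yE qp qu] mc.
exists (size q), (nth x (x :: q)); split=> //.
- split=> t tn; first exact: (pathP x qp).
  have /mc : infix [:: nth x (x :: q) t; nth x (x :: q) t.+1; nth x (x :: q) t.+2] (x :: q).
    by apply/(infix3P x); exists t.
  rewrite /triple_ok; case: ifP => // _ [s sZ].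
  by rewrite inE => ts; apply/ancP; exists s.
- by rewrite -yE (last_nth x).
- by move=> s t /andP[st tn]; rewrite (nth_uniq x _ _ qu) /=; lia.
Qed.

Hypothesis Ganc : ancestral G.

Lemma walk_m_connected Z n v : mwalk Z n v -> v 0 != v n ->
  m_connected G Z (v 0) (v n).
Proof.
(* Unit weights make minimal walks the shortest ones, which repeat no vertex and so are paths. *)
move=> vw vn; have [m [w [wmin <- <-]]] := minimal_walk_exists (fun=> 1) vw.
have winj := minimal_walk_inj Ganc (f := fun=> 1) (fun=> isT) wmin.
case: wmin => -[wadj wok] _ {n v vw vn}.
have nthE t : t < m.+1 -> nth (w 0) (mkseq w m.+1) t = w t by exact: nth_mkseq.
exists (mkseq w m.+1); last first.
  move=> a k b /(infix3P (w 0))[t []]; rewrite size_mkseq => tm.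
  rewrite !nthE; try lia.
  move=> <- <- <-; have := wok t; rewrite /triple_ok ltnS in tm * => /(_ tm).
  by case: ifP => // _ /ancP[s sZ ts]; exists s; rewrite ?inE.
have mE : mkseq w m.+1 = w 0 :: map w (iota 1 m) by [].
rewrite mE /=; apply/and4P; split; first exact: eqxx.
- by rewrite (last_nth (w 0)) -mE size_map size_iota nthE.
- apply/(pathP (w 0)) => t; rewrite size_map size_iota => tm.
  rewrite -mE nthE ?(nth_map 0) ?size_iota // ?nth_iota //; last by lia.
  by rewrite add1n; apply: wadj.
- rewrite -[X in is_true X]/(uniq (mkseq w m.+1)) map_inj_in_uniq ?iota_uniq // => s t.
  rewrite !mem_iota /= !add0n !ltnS => sm tm st.
  by apply/eqP; case: ltngtP => // lt; [have := winj s t|have := winj t s];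
    rewrite st eqxx lt ?sm ?tm => /(_ isT).
Qed.

Lemma reach_m_connected S x y h : x != y ->
  reach G (anc G (S :|: [set x; y])) S x h y -> m_connected G S x y.
Proof.
move=> xy /(reach_relax Ganc).
suff H h' : reach G (anc G S) S x h' y -> m_connected G S x y by case=> [/H|[h' /H]].
move=> /reach_walk[n [v [vw vx vy _]]].
by have := walk_m_connected vw; rewrite vx vy; apply.
Qed.

Lemma walk_relax S n v : v 0 != v n ->
  walk G (anc G (S :|: [set v 0; v n])) S n v -> m_connected G S (v 0) (v n).
Proof.
case: n => [|n] vn /=; first by rewrite eqxx in vn.
by move=> /walk_reach; apply: reach_m_connected.
Qed.

Lemma m_connected_sym S x y : x != y -> m_connected G S x y -> m_connected G S y x.
Proof.
move=> xy /m_connected_walk[n [v [vw vx vy _]]].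
have := walk_m_connected (walk_rev vw); rewrite subn0 subnn vx vy eq_sym; exact.
Qed.

Lemma adj_m_connected S x y : adj G x y -> m_connected G S x y.
Proof.
move=> xy; have := @walk_m_connected S 1 (fun t => if t is 0 then x else y).
by move=> /=; apply; [split=> // -[]|apply: adj_neq xy].
Qed.

(** [v] is an inducing path, up to repeated vertices: [walk_relax] tolerates colliders that are
    ancestors of the ends, whatever [S] is. *)
Lemma inducing_m_connected S n v : v 0 != v n ->
  (forall t, t < n -> adj G (v t) (v t.+1)) ->
  (forall t, t.+1 < n -> collider G (v t) (v t.+1) (v t.+2)) ->
  (forall t, t.+1 < n -> v t.+1 \in anc G [set v 0; v n]) ->
  m_connected G S (v 0) (v n).
Proof.
move=> vn vadj vc va; apply: walk_relax => //; split=> // t tn.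
by rewrite /triple_ok vc // ancU va ?orbT.
Qed.

Definition inseparable x y : Prop :=
  forall S : {set V}, S \subset ~: [set x; y] -> m_connected G S x y.

Lemma sub_setC2 (S : {set V}) x y :
  (S \subset ~: [set x; y]) = (x \notin S) && (y \notin S).
Proof. by rewrite finset.subsetC finset.subUset !finset.sub1set !inE. Qed.

(* Every vertex of the path is an ancestor of x or y, so a non-collider would lie
   in the conditioning set. *)
Lemma m_connected_anc_inducing x y : x != y ->
  m_connected G (anc G [set x; y] :\: [set x; y]) x y ->
  exists n v, [/\ v 0 = x, v n = y,
    forall t, t < n -> adj G (v t) (v t.+1),
    forall t, t.+1 < n -> collider G (v t) (v t.+1) (v t.+2) &
    forall t, t.+1 < n -> v t.+1 \in anc G [set x; y]].
Proof.
move=> xy /m_connected_walk[n [v [vw vx vy vinj]]]; exists n, v.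
have va t : t <= n -> v t \in anc G [set x; y].
  move=> tn; have := walk_anc Ganc vw tn; rewrite ancU vx vy => /orP[|//].
  case/ancP=> s /setDP[/ancP[s' s'xy ss'] _] ts; apply/ancP; exists s' => //.
  exact: connect_trans ss'.
case: vw => vadj vok; split=> // t tn; last by apply: va; lia.
have := vok t tn; rewrite /triple_ok; case: ifP => // _.
rewrite finset.in_setD finset.in_set2 va ?andbT; last by lia.
have /negbTE v0t : v 0 != v t.+1 by apply: vinj; lia.
have /negbTE vtn : v t.+1 != v n by apply: vinj; lia.
by rewrite negbK -vx -vy eq_sym v0t vtn.
Qed.

Lemma m_connected_anc_inseparable x y : x != y ->
  m_connected G (anc G [set x; y] :\: [set x; y]) x y -> forall S, m_connected G S x y.
Proof.
move=> xy /(m_connected_anc_inducing xy)[n [v [vx vy vadj vc va]]] S.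
by rewrite -vx -vy in xy va *; apply: inducing_m_connected.
Qed.

Lemma inseparable_all x y : x != y -> inseparable x y -> forall S, m_connected G S x y.
Proof.
move=> xy ns; apply: m_connected_anc_inseparable => //; apply: ns.
by rewrite sub_setC2 !inE !eqxx orbT.
Qed.

Lemma maximal_separated x y : maximal G -> x != y -> ~~ adj G x y ->
  ~ m_connected G (anc G [set x; y] :\: [set x; y]) x y.
Proof.
move=> Gmax xy nxy /(m_connected_anc_inseparable xy) ns.
by have [S _] := Gmax _ _ xy nxy; apply.
Qed.

End Connection.

(** * Maximal completions *)

Section Models.
Variable V : finType.
Implicit Types (G H : mgraph V) (i j k a b c x y : V) (C S Z : {set V}) (v w : nat -> V).

Lemma msep_model_eq G H :
  (forall x y Z, x != y -> x \notin Z -> y \notin Z ->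
     m_connected G Z x y <-> m_connected H Z x y) ->
  msep_model G = msep_model H.
Proof.
move=> GH; apply/funext => -[[A B] C]; apply/propext; rewrite /msep_model /=.
split=> -[/and3P[dAB dAC dBC] ms]; split; rewrite /pairwise_disjoint ?dAB ?dAC //.
all: move=> a b aA bB ab; apply: (ms a b aA bB); apply/GH => //.
all: try by rewrite (disjointFr dAC).
all: try by rewrite (disjointFr dBC).
all: by apply: contraTneq aA => ->; rewrite (disjointFl dAB).
Qed.

Lemma msep_model_m_connected G H x y Z : msep_model G = msep_model H ->
  x != y -> x \notin Z -> y \notin Z ->
  m_connected G Z x y -> m_connected H Z x y.
Proof.
move=> GH xy xZ yZ xyG; apply: contrapT => xyH.
have : msep_model G ([set x]%SET, [set y]%SET, Z).
  rewrite GH; split=> /=.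
    by rewrite /pairwise_disjoint !disjoints1 finset.in_set1 xy xZ yZ.
  by move=> a b /set1P-> /set1P->.
by case=> _ /(_ x y (set11 _) (set11 _)).
Qed.

Lemma set2_eq a b i j : [set a; b] = [set i; j] :> {set V} ->
  (a = i /\ b = j) \/ (a = j /\ b = i).
Proof.
move=> E; have /set2P ha : a \in [set i; j] by rewrite -E set21.
have /set2P hb : b \in [set i; j] by rewrite -E set22.
have /set2P hi : i \in [set a; b] by rewrite E set21.
have /set2P hj : j \in [set a; b] by rewrite E set22.
by case: ha hb hi hj => -> [] -> [] ? [] ?; subst; auto.
Qed.

Definition skel G : {set {set V}} :=
  ((fun e => [set e.1; e.2]) @: dir G :|: bid G)%SET.

Lemma mem_skel G a b : ([set a; b] \in skel G) = adj G a b.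
Proof.
rewrite finset.in_setU /adj /bedge orbA; congr (_ || _).
apply/imsetP/idP => [[[i j] ij /= /set2_eq[][-> ->]]|/orP[ab|ba]].
- by rewrite /dedge ij.
- by rewrite /dedge ij orbT.
- by exists (a, b).
- by exists (b, a) => //=; rewrite finset.setUC.
Qed.

Lemma skel_adj G e : e \in skel G -> exists a b, e = [set a; b]%SET /\ adj G a b.
Proof.
move=> eG; suff [a [b E]] : exists a b, e = [set a; b]%SET.
  by exists a, b; split=> //; rewrite -mem_skel -E.
case/finset.setUP: eG => [/imsetP[[a b] _ ->]|/(forall_inP (bid_card2 G))/cards2P].
  by exists a, b.
by case=> a [b [_ ->]]; exists a, b.
Qed.

(** In an ancestral graph two vertices are joined by at most one edge. *)
Lemma gsizeE G : ancestral G -> gsize G = #|skel G|.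
Proof.
move=> Ganc; rewrite /skel cardsU card_in_imset.
  rewrite (_ : _ :&: _ = finset.set0) ?cards0 ?subn0 //.
  apply/setP => e; rewrite !inE; apply/negP => /andP[/imsetP[[a b] ab ->] /= e'].
  by have /negP[] := Ganc.2 a b e'; apply: connect1.
move=> [a b] [i j] ab ij /set2_eq[][/= aE bE] //; subst=> //.
by have /negP[] := dedge_nconnect Ganc ab; apply: connect1.
Qed.

Lemma sub_skel G H : (forall a b, adj G a b -> adj H a b) -> skel G \subset skel H.
Proof.
move=> GH; apply/fintype.subsetP => e /skel_adj[a [b [-> /GH]]].
by rewrite mem_skel.
Qed.

Lemma gsize_le G H : ancestral G -> ancestral H ->
  (forall a b, adj G a b -> adj H a b) -> gsize G <= gsize H.
Proof. by move=> Ga Ha /sub_skel GH; rewrite !gsizeE // subset_leq_card. Qed.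

Lemma gsize_adj G H : ancestral G -> ancestral H ->
  (forall a b, adj G a b -> adj H a b) -> gsize H <= gsize G ->
  forall a b, adj H a b -> adj G a b.
Proof.
move=> Ga Ha /sub_skel GH; rewrite !gsizeE // => HG a b.
have /eqP E : skel G == skel H by rewrite eqEcard GH.
by rewrite -!mem_skel E.
Qed.

Lemma into_bedge G a b : bedge G a b -> into G a b.
Proof. by rewrite /into => ->; rewrite orbT. Qed.

Lemma into_into_bedge G a b : ancestral G -> into G a b -> into G b a -> bedge G a b.
Proof.
move=> Ganc /orP[/(dedge_ninto Ganc) -> //|//].
Qed.

Lemma inseparable_sym G x y : ancestral G -> x != y ->
  inseparable G x y -> inseparable G y x.
Proof.
move=> Ganc xy ns S Sxy; apply: m_connected_sym => //; apply: ns.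
by rewrite finset.setUC.
Qed.

(** The first and last interior vertices of an inducing path receive arrowheads from [x] and [y], so
    they are ancestors of [y] and [x] respectively. A directed edge at either end, or a directed
    path between [x] and [y], would run against one of these arrowheads. *)
Lemma inseparable_bidirected G x y : ancestral G -> x != y -> ~~ adj G x y ->
  inseparable G x y ->
  ~~ connect (dedge G) x y /\
  exists n v, [/\ v 0 = x, v n.+1 = y, forall t, t < n.+1 -> bedge G (v t) (v t.+1) &
    forall t, t < n -> v t.+1 \in anc G [set x; y]].
Proof.
move=> Ganc xy nxy ns.
have := inseparable_all Ganc xy ns (anc G [set x; y] :\: [set x; y]).
case/(m_connected_anc_inducing Ganc xy) => -[|[|n]] [v [vx vy vadj vc va]].
- by rewrite -vx -vy eqxx in xy.
- by have := vadj 0; rewrite vx vy (negbTE nxy) => /(_ isT).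
have ix : into G x (v 1) by rewrite -vx; case/andP: (vc 0 isT).
have iy : into G y (v n.+1) by rewrite -vy; case/andP: (vc n (leqnn _)).
have cy : connect (dedge G) (v 1) y.
  by have := va 0 isT; rewrite anc2 (negbTE (into_nconnect Ganc ix)).
have cx : connect (dedge G) (v n.+1) x.
  by have := va n (leqnn _); rewrite anc2 (negbTE (into_nconnect Ganc iy)) orbF.
have nc : ~~ connect (dedge G) x y.
  by apply: contra (into_nconnect Ganc iy); apply: connect_trans.
have nc' : ~~ connect (dedge G) y x.
  by apply: contra (into_nconnect Ganc ix); apply: connect_trans.
split=> //; exists n.+1, v; split=> // t tn.
have [tn'|tn'] := ltnP t n.+1; last first.
  have -> : t = n.+1 by lia.
  rewrite vy bedge_sym; case/orP: iy => // yv.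
  by case/negP: nc'; apply: connect_trans (connect1 yv) cx.
case: t tn tn' => [|t] tn tn'.
  rewrite vx; case/orP: ix => // xv.
  by case/negP: nc; apply: connect_trans (connect1 xv) cy.
apply: into_into_bedge => //; first by case/andP: (vc t.+1 tn').
by case/andP: (vc t tn).
Qed.

Section Completion.
Variable G : mgraph V.
Hypothesis Ganc : ancestral G.

(** The pairs at which maximality of [G] fails; the completion joins all of them at once by
    bidirected edges. *)
Definition new_edge x y : bool :=
  [&& x != y, ~~ adj G x y & `[< inseparable G x y >]].

Lemma new_edge_sym x y : new_edge x y = new_edge y x.
Proof.
suff imp a b : new_edge a b -> new_edge b a by apply/idP/idP; apply: imp.
case/and3P => ab nab /asboolP ns; rewrite /new_edge eq_sym ab adj_sym nab /=.
exact/asboolP/inseparable_sym.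
Qed.

Definition completion_bid : {set {set V}} :=
  (bid G :|: [set e | [exists i, exists j, (e == [set i; j]) && new_edge i j]])%SET.

Fact completion_card2 : [forall e in completion_bid, #|e : {set V}| == 2].
Proof.
apply/forall_inP => e; rewrite !inE => /orP[/(forall_inP (bid_card2 G)) //|].
by case/existsP=> i /existsP[j /andP[/eqP-> /and3P[ij _ _]]]; rewrite cards2 ij.
Qed.

Definition completion : mgraph V := MGraph (dir_irr G) completion_card2.

Lemma bedge_completion x y : bedge completion x y = bedge G x y || new_edge x y.
Proof.
rewrite /bedge /= !inE; congr (_ || _).
apply/existsP/idP => [[i /existsP[j /andP[/eqP/set2_eq[][-> ->]]]]|xy] //.
  by rewrite new_edge_sym.
by exists x; apply/existsP; exists y; rewrite eqxx.
Qed.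

Lemma adj_completion x y : adj completion x y = adj G x y || new_edge x y.
Proof. by rewrite /adj bedge_completion !orbA. Qed.

Lemma into_completion x y : into completion x y = into G x y || new_edge x y.
Proof. by rewrite /into bedge_completion orbA. Qed.

Lemma new_edgeF x y : adj G x y -> new_edge x y = false.
Proof. by rewrite /new_edge => ->; rewrite andbF. Qed.

Lemma completion_ancestral : ancestral completion.
Proof.
split; first exact: Ganc.1.
move=> x y; rewrite bedge_completion => /orP[/Ganc.2 //|/and3P[xy nxy /asboolP ns]].
by case: (inseparable_bidirected Ganc xy nxy ns).
Qed.

Lemma reach_bidirected C S x m v : (forall t, t < m.+1 -> bedge G (v t) (v t.+1)) ->
  (forall t, t < m -> v t.+1 \in C) ->
  reach G C S x true (v 1) -> reach G C S x true (v m.+1).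
Proof.
elim: m => [|m IH] vb vC r1 //.
have r : reach G C S x true (v m.+1).
  by apply: IH => // t tm; [apply: vb|apply: vC]; lia.
have b := vb m.+1 (leqnn _).
have := reach_step r (bedge_adj b); rewrite (into_bedge b).
by rewrite into_bedge ?(bedge_sym G (v m.+2)) //; apply; apply: vC.
Qed.

(** An added edge is replaced by the bidirected walk of [inseparable_bidirected], which has the same
    arrowheads at its ends. Its inner vertices are ancestors of [S], [x] or [y], which
    [reach_m_connected] accepts as colliders. *)
Lemma completion_m_connected S x y : x != y ->
  m_connected completion S x y <-> m_connected G S x y.
Proof.
move=> xy; split=> /m_connected_walk[n [v [vw vx vy _]]]; last first.
  have := @walk_m_connected _ _ completion_ancestral S n v; rewrite vx vy; apply=> //.
  have vadj := vw.1; split=> t tn; first by rewrite adj_completion vadj.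
  have := vw.2 t tn; rewrite /triple_ok /collider !into_completion !new_edgeF ?orbF //.
  - by rewrite adj_sym; apply: vadj; lia.
  - by apply: vadj; lia.
set C := anc G (S :|: [set x; y]).
have vC t : t <= n -> v t \in C.
  by move=> tn; have := walk_anc completion_ancestral vw tn; rewrite vx vy.
suff key t : t < n -> reach G C S x (into completion (v t) (v t.+1)) (v t.+1).
  case: n vw vx vy vC key => [|n] _ vx vy _ key; first by rewrite -vx -vy eqxx in xy.
  by have := key n (leqnn _); rewrite vy; apply: reach_m_connected.
(* [ok] abstracts the condition on the arrowhead at [v r], so that one argument serves the first
   edge and all later ones. *)
have step r (ok : bool -> bool) : r < n -> (forall u, adj G (v r) u ->
      ok (into G u (v r)) -> reach G C S x (into G (v r) u) u) ->
    ok (into completion (v r.+1) (v r)) ->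
    reach G C S x (into completion (v r) (v r.+1)) (v r.+1).
  move=> rn go; rewrite !into_completion (new_edge_sym (v r.+1)).
  have := vw.1 r rn; rewrite adj_completion; case/orP => [tt|new].
    by rewrite new_edgeF // !orbF; apply: go.
  rewrite new !orbT; have /and3P[tt ntt /asboolP ns] := new.
  have [_ [m [w [w0 wm wb wa]]]] := inseparable_bidirected Ganc tt ntt ns.
  move=> okt; rewrite -wm; apply: reach_bidirected => //.
    move=> s sm; have := wa s sm.
    by rewrite anc2 => /orP[|] /anc_connect; apply; apply: vC; lia.
  have b := wb 0 isT; rewrite -(into_bedge b) w0.
  by apply: go; rewrite -w0 ?bedge_adj // into_bedge // bedge_sym.
elim: t => [|t IH] tn.
  apply: (step _ xpredT) => // u; rewrite vx => xu _; exact: reach_edge.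
have tn' : t < n by lia.
apply: (step _ (fun h => if into completion (v t) (v t.+1) && h then v t.+1 \in C
                         else v t.+1 \notin S)) => // [u|].
  by move=> tu; apply: reach_step (IH tn') tu.
have := vw.2 t tn; rewrite /triple_ok /collider; case: ifP => // _ vS.
by rewrite /C ancU; apply/orP; left.
Qed.

Lemma completionP : is_maximal_completion G completion.
Proof.
have E : msep_model completion = msep_model G.
  by apply: msep_model_eq => x y Z xy _ _; apply: completion_m_connected.
split=> //; last by rewrite /= finset.subsetUl.
split; first exact: completion_ancestral.
move=> x y xy; rewrite adj_completion negb_or => /andP[nxy].
rewrite /new_edge xy nxy /= => /asboolPn ns.
have [S /not_implyP[Sxy nS]] := (existsNP _).2 ns.
exists S => //; apply: contra_not nS; exact: (completion_m_connected S xy).1.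
Qed.

End Completion.

Lemma maximal_completionP G : ancestral G ->
  is_maximal_completion G (maximal_completion G).
Proof.
move=> Ganc; rewrite /maximal_completion; case: pselect => [e|[]].
  by case: (cid e).
by exists (completion G); apply: completionP.
Qed.

End Models.

(** * Minimal m-connecting walks *)

Section MinimalStructure.
Variable V : finType.
Implicit Types (G H : mgraph V) (i j k a b c x y : V) (C S Z : {set V}) (u v : nat -> V).

(** The weight for minimal walks: it drops strictly along directed edges, so passing through a child
    of a collider is cheaper than through the collider. *)
Definition ndesc G k := #|[set s | connect (dedge G) k s]|.

Lemma ndesc_gt0 G k : 0 < ndesc G k.
Proof. by apply/card_gt0P; exists k; rewrite inE connect0. Qed.

Lemma ndesc_dedge G a b : ancestral G -> dedge G a b -> ndesc G b < ndesc G a.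
Proof.
move=> Ganc ab; apply/proper_card/properP; split.
  by apply/fintype.subsetP => s; rewrite !inE; apply: connect_trans (connect1 ab).
by exists a; rewrite !inE ?connect0 // dedge_nconnect.
Qed.

Lemma weight_rev f n v : weight f n (fun t => v (n - t) : V) = weight f n v.
Proof.
rewrite /weight big_nat_rev /= add0n; apply: eq_big_nat => t /andP[_ tn].
by congr (f (v _)); nlia.
Qed.

Lemma minimal_walk_rev f G Z n v :
  minimal_walk G f Z n v -> minimal_walk G f Z n (fun t => v (n - t)).
Proof.
case=> vw vmin; split; first exact: walk_rev.
rewrite subn0 subnn => m w ww w0 wm; rewrite weight_rev -(weight_rev f m).
by apply: vmin; rewrite ?subn0 ?subnn //; apply: walk_rev.
Qed.

(* u 0, ..., u m.+1, j, where j is a child of the colliders u 1, ..., u m in Z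
   and is not adjacent to u 0: a discriminating path for u m.+1 if m > 0, an
   unshielded triple if m = 0. *)
Definition disc G Z u m j : Prop :=
  [/\ forall t, t <= m -> adj G (u t) (u t.+1),
      forall t, t < m -> [/\ collider G (u t) (u t.+1) (u t.+2), u t.+1 \in Z &
                             dedge G (u t.+1) j],
      adj G (u m.+1) j, u 0 != j & ~~ adj G (u 0) j].

Lemma disc_ext G Z u u' m j : (forall s, s <= m.+1 -> u s = u' s) ->
  disc G Z u m j -> disc G Z u' m j.
Proof.
move=> uu' [uadj good mj uj nuj]; rewrite /disc -!uu' //; split=> // s sm.
  by rewrite -!uu' ?uadj //; nlia.
by rewrite -!uu'; [apply: good|nlia..].
Qed.

(** The stretches of [m.+1] edges of [v] on either side of [t], both read towards [t], so that index
    [m.+1] is [v t]. *)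
Definition lwin v t m s : V := v (t - m.+1 + s).
Definition rwin v t m s : V := v (t + m.+1 - s).

Lemma lwin_disc G Z n v l t j : walk G (anc G Z) Z n v -> l < t <= n ->
  (forall s, l < s < t -> [/\ collider G (v s.-1) (v s) (v s.+1), v s \in Z &
                             dedge G (v s) j]) ->
  adj G (v t) j -> v l != j -> ~~ adj G (v l) j ->
  exists m, m < t /\ disc G Z (lwin v t m) m j.
Proof.
move=> [vadj _] /andP[lt tn] good tj lj nlj; exists (t - l.+1); rewrite /lwin.
have -> : t - (t - l.+1).+1 = l by nlia.
split; first by nlia.
split; rewrite ?addn0 //.
- by move=> s sm; rewrite addnS; apply: vadj; nlia.
- by move=> s sm; have := good (l + s.+1); rewrite addnS !addnS /=; apply; nlia.
- by rewrite (_ : l + _ = t) //; nlia.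
Qed.

Lemma rwin_disc G Z n v r t j : walk G (anc G Z) Z n v -> t < r <= n ->
  (forall s, t < s < r -> [/\ collider G (v s.-1) (v s) (v s.+1), v s \in Z &
                             dedge G (v s) j]) ->
  adj G (v t) j -> v r != j -> ~~ adj G (v r) j ->
  exists m, t + m.+1 <= n /\ disc G Z (rwin v t m) m j.
Proof.
move=> [vadj _] /andP[tr rn] good tj rj nrj; exists (r - t.+1); rewrite /rwin.
have -> : t + (r - t.+1).+1 = r by nlia.
split=> //; split; rewrite ?subn0 //.
- move=> s sm; rewrite adj_sym; have -> : r - s = (r - s.+1).+1 by nlia.
  by apply: vadj; nlia.
- move=> s sm; have := good (r - s.+1); rewrite collider_sym.
  have -> : (r - s.+1).-1 = r - s.+2 by nlia.
  have -> : (r - s.+1).+1 = r - s by nlia.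
  by apply; nlia.
- by rewrite (_ : r - _ = t) //; nlia.
Qed.

Section Minimal.
Variables (G : mgraph V) (Z : {set V}).
Hypothesis Ganc : ancestral G.

Notation mwalk := (walk G (anc G Z) Z).

(** The scan passes over colliders in [Z] that are parents of [j]. It stops at the first other
    vertex or at the end of the walk: either [j] is not adjacent there, or the walk can be entered
    there from [j]. *)
Lemma scan_right n v s j : mwalk n v -> s < n ->
  into G (v s.+1) (v s) -> dedge G (v s) j ->
  exists r, [/\ s < r <= n,
    forall t, s < t < r -> [/\ collider G (v t.-1) (v t) (v t.+1), v t \in Z &
                             dedge G (v t) j],
    v r != j &
    ~~ adj G (v r) j \/ (into G (v r) j /\
      (r < n -> triple_ok G (anc G Z) Z j (v r) (v r.+1)))].
Proof.
move=> vw; have [vadj vok] := vw.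
have [d] := ubnP (n - s); elim: d s => // d IH s sd sn is1 sj.
have s1j : v s.+1 != j by apply: contraTneq is1 => ->; rewrite dedge_ninto.
have [s1j'|s1j'] := boolP (adj G (v s.+1) j); last first.
  by exists s.+1; rewrite leqnn sn; split=> // [t|]; [nlia|left].
have is1j := into_trans Ganc is1 sj s1j'.
have [s1n|s1n] := ltnP s.+1 n; last first.
  by exists s.+1; rewrite leqnn sn; split=> // [t|]; [nlia|right; split=> //; nlia].
have [/and3P[c1 z1 d1]|ng] := boolP
  [&& collider G (v s) (v s.+1) (v s.+2), v s.+1 \in Z & dedge G (v s.+1) j].
  have [||||r [/andP[sr rn] good rj last]] := IH s.+1 => //; first by nlia.
    by case/andP: c1.
  exists r; rewrite rn (ltnW sr); split=> // t /andP[st tr].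
  have [->|ts] := eqVneq t s.+1; first by split.
  by apply: good; nlia.
exists s.+1; rewrite leqnn sn; split=> // [t|]; first by nlia.
(* Replacing [v s] by [j] keeps the triple admissible. If a collider becomes a non-collider, then
   [v s.+1] is a parent of [j], which the scan would have passed over were it in [Z]. If a
   non-collider became a collider, [v s.+1 -> v s -> j] would force [v s.+1 -> j]. *)
right; split=> // _; have := vok s s1n; rewrite /triple_ok.
have a1 : adj G (v s) (v s.+1) by apply: vadj.
have a2 : adj G (v s.+1) (v s.+2) by apply: vadj.
have j1 : adj G j (v s.+1) by rewrite adj_sym.
have [c1|c1] := boolP (collider G (v s) (v s.+1) (v s.+2)) => ok1.
  case: ifPn => //; rewrite ncollider_out // => /orP[d1|d1].
    by apply: contra ng => z1; rewrite c1 z1.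
  by case/andP: c1; rewrite (dedge_ninto Ganc d1).
case: ifP => // /andP[i1 i2].
move: c1; rewrite ncollider_out // => /orP[d1|/(dedge_ninto Ganc)]; last by rewrite i2.
by have := dedge_ninto Ganc (dedge_trans Ganc d1 sj s1j'); rewrite i1.
Qed.

Lemma scan_left n v s j : mwalk n v -> 0 < s <= n ->
  into G (v s.-1) (v s) -> dedge G (v s) j ->
  exists l, [/\ l < s,
    forall t, l < t < s -> [/\ collider G (v t.-1) (v t) (v t.+1), v t \in Z &
                             dedge G (v t) j],
    v l != j &
    ~~ adj G (v l) j \/ (into G (v l) j /\
      (0 < l -> triple_ok G (anc G Z) Z (v l.-1) (v l) j))].
Proof.
move=> vw /andP[s0 sn] is1 sj.
have e1 : n - (n - s) = s by nlia.
have e2 : n - (n - s).+1 = s.-1 by nlia.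
have [||| r [/andP[sr rn] good rj last]] := scan_right (s := n - s) (j := j) (walk_rev vw).
- by nlia.
- by rewrite e1 e2.
- by rewrite e1.
exists (n - r); split=> //; first by nlia.
  move=> t /andP[lt ts]; have e : n - (n - t) = t by nlia.
  have := good (n - t); rewrite e collider_sym.
  rewrite (_ : n - (n - t).+1 = t.-1); last by nlia.
  by rewrite (_ : n - (n - t).-1 = t.+1); [apply; nlia|nlia].
case: last => [|[ij ok]]; [by left|right; split=> // l0].
by rewrite triple_ok_sym (_ : (n - r).-1 = n - r.+1); [apply: ok; nlia|nlia].
Qed.

Section Interior.
Variables (n : nat) (v : nat -> V) (t : nat).
Hypothesis vmin : minimal_walk G (ndesc G) Z n v.
Hypothesis tn : 0 < t < n.

(** If both scans from [v t] ended with an arrowhead at [w], the walk between their ends could be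
    replaced by [w], a collider in [anc G Z] with fewer descendants than [v t]. By minimality one
    scan ends at a non-neighbour of [w]. *)
Lemma minimal_child w : collider G (v t.-1) (v t) (v t.+1) ->
  dedge G (v t) w -> w \in anc G Z ->
  (exists m, m < t /\ disc G Z (lwin v t m) m w) \/
  (exists m, t + m.+1 <= n /\ disc G Z (rwin v t m) m w).
Proof.
move=> /andP[i1 i2] tw wZ; have [vw vle] := vmin; have /andP[t0 tn'] := tn.
have [r [/andP[tr rn] goodr rw lastr]] := scan_right vw tn' i2 tw.
have t0n : 0 < t <= n by rewrite t0 ltnW.
have [l [lt goodl lw lastl]] := scan_left vw t0n i1 tw.
case: lastr => [nrw|[irw okr]].
  by right; apply: rwin_disc vw _ goodr (dedge_adj tw) rw nrw; rewrite tr.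
case: lastl => [nlw|[ilw okl]].
  by left; apply: lwin_disc vw _ goodl (dedge_adj tw) lw nlw; rewrite lt ltnW.
have ww : walk G (anc G Z) Z 0 (fun=> w) by [].
have wsuf : mwalk (0 + (n - r).+1) (catw 0 (fun=> w) (fun t => v (r + t))).
  apply: walk_cat; rewrite ?addn0 ?addn1 //.
  - exact: walk_suffix.
  - by rewrite adj_sym; apply: into_adj.
  - by move=> h; apply: okr; nlia.
have wnew : mwalk (l + (0 + (n - r).+1).+1) (catw l v (catw 0 (fun=> w) (fun t => v (r + t)))).
  apply: walk_cat wsuf _ okl _.
  - by apply: walk_prefix vw; nlia.
  - exact: into_adj.
  - by rewrite /catw /= addn0 /triple_ok /collider ilw irw.
have := vle _ _ wnew erefl; rewrite !catw_last subnKC // => /(_ erefl).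
rewrite !weight_cat (weight_split _ v (ltn_trans lt tr) rn) -addnA leq_add2l leq_add2r.
rewrite {1}/weight big_nat1 leqNgt => /negP[].
apply: leq_trans (ndesc_dedge Ganc tw) _.
rewrite (@big_cat_nat _ _ _ t) //=; [|nlia..].
by rewrite (@big_ltn _ _ _ t) // addnCA leq_addr.
Qed.

(** If the shortcut from [a] to [c] turned [c] into a collider outside [anc G Z], then [c -> b] and
    [b] would be a collider in [anc G Z], taking [c] along. So the only defect is a collider [c] in
    [Z] that becomes a non-collider. *)
Lemma splice_defect a b c d : adj G a b -> adj G b c -> adj G c d -> adj G a c ->
  triple_ok G (anc G Z) Z b c d -> ~~ triple_ok G (anc G Z) Z a c d ->
  triple_ok G (anc G Z) Z a b c ->
  [/\ collider G b c d, c \in Z & dedge G c a].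
Proof.
move=> ab bc cd ac; rewrite /triple_ok => okc nok okb.
move: nok; case: ifPn => [/andP[iac idc] ncZ|].
  move: okc; rewrite (negbTE ncZ); case: ifPn => // nc _; case/negP: ncZ.
  move: nc; rewrite ncollider_out // => /orP[cb|/(dedge_ninto Ganc)]; last by rewrite idc.
  by move: okb; rewrite /collider (into_trans Ganc iac cb ab) {1}/into cb; apply: anc_dedge.
rewrite ncollider_out // negbK => out cZ; move: okc; rewrite cZ; case: ifP => // col _.
split=> //; case/orP: out => // /(dedge_ninto Ganc) cdF.
by case/andP: col; rewrite cdF.
Qed.

(** By [splice_defect], [v t.+1] is a parent of [v t.-1], which starts a scan with [j := v t.-1].
    Ending at a neighbour of [j], it would allow a splice against minimality. *)
Lemma minimal_shielded_right : adj G (v t.-1) (v t.+1) ->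
  t.+1 < n -> ~~ triple_ok G (anc G Z) Z (v t.-1) (v t.+1) (v t.+2) ->
  exists m, t + m.+1 <= n /\ disc G Z (rwin v t m) m (v t.-1).
Proof.
move=> ac t1n nok; have [vw _] := vmin; have [vadj vok] := vw; have /andP[t0 tn'] := tn.
have ab : adj G (v t.-1) (v t) by have := vadj t.-1; rewrite prednK //; apply; nlia.
have okb : triple_ok G (anc G Z) Z (v t.-1) (v t) (v t.+1).
  by have := vok t.-1; rewrite prednK //; apply.
have bc : adj G (v t) (v t.+1) by apply: vadj.
have cd : adj G (v t.+1) (v t.+2) by apply: vadj.
have [col cZ ca] := splice_defect ab bc cd ac (vok t t1n) nok okb.
have /andP[ibc idc] := col.
have [r [/andP[tr rn] good rj last]] := scan_right vw t1n idc ca.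
have goodr s : t < s < r -> [/\ collider G (v s.-1) (v s) (v s.+1), v s \in Z &
                               dedge G (v s) (v t.-1)].
  move=> /andP[ts sr]; have [->|ns] := eqVneq s t.+1; first exact: And3 col cZ ca.
  by apply: good; nlia.
case: last => [nrj|[irj okr]].
  by apply: rwin_disc vw _ goodr _ rj nrj; [nlia|rewrite adj_sym].
exfalso; apply: (minimal_walk_splice (@ndesc_gt0 G) vmin (l := t.-1) (r := r)) => //.
- by nlia.
- by rewrite adj_sym; apply: into_adj.
(* The old edge to [v t] has an arrowhead at [v t.-1], like the new one, so the triple there keeps
   its status. *)
- move=> l0; have iba : into G (v t) (v t.-1).
    by apply: into_trans ibc ca _; rewrite // adj_sym.
  have e1 : t.-2.+1 = t.-1 by nlia.
  have e2 : t.-1.+1 = t by nlia.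
  have := vok t.-2; rewrite e1 e2 => /(_ (ltnW tn')).
  by rewrite /triple_ok /collider iba irj.
Qed.

End Interior.

(** If the neighbours of [v t] on the walk are adjacent, bypassing [v t] must spoil the triple at
    one of them, by minimality; if not, [m = 0] works. *)
Lemma minimal_triple n v t : minimal_walk G (ndesc G) Z n v -> 0 < t < n ->
  (exists m, m < t /\ disc G Z (lwin v t m) m (v t.+1)) \/
  (exists m, t + m.+1 <= n /\ disc G Z (rwin v t m) m (v t.-1)).
Proof.
move=> vmin tn; have [vw _] := vmin; have /andP[t0 tn'] := tn.
have vinj := minimal_walk_inj Ganc (@ndesc_gt0 G) vmin.
have [vadj vok] := vw.
have ac : v t.-1 != v t.+1 by apply: vinj; nlia.
have [aac|nac] := boolP (adj G (v t.-1) (v t.+1)); last first.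
  left; apply: lwin_disc vw _ _ _ ac nac; [nlia|by move=> s; nlia|exact: vadj].
have [/andP[t1n nok]|okr] :=
  boolP ((t.+1 < n) && ~~ triple_ok G (anc G Z) Z (v t.-1) (v t.+1) (v t.+2)).
  by right; apply: minimal_shielded_right.
have [/andP[t1 nok]|okl] :=
  boolP ((0 < t.-1) && ~~ triple_ok G (anc G Z) Z (v t.-2) (v t.-1) (v t.+1)).
  left; have e : n - (n - t) = t by nlia.
  have e1 : n - (n - t).-1 = t.+1 by nlia.
  have e2 : n - (n - t).+1 = t.-1 by nlia.
  have e3 : n - (n - t).+2 = t.-2 by nlia.
  have := minimal_shielded_right (t := n - t) (minimal_walk_rev vmin).
  rewrite e1 e2 e3 adj_sym triple_ok_sym => /(_ _ aac _ nok)[||m [tm dm]]; [nlia|nlia|].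
  exists m; split; first by nlia.
  by apply: disc_ext dm => s sm; rewrite /rwin /lwin; congr v; nlia.
exfalso; apply: (minimal_walk_splice (@ndesc_gt0 G) vmin (l := t.-1) (r := t.+1)) => //.
- by nlia.
- by move=> l0; move: okl; rewrite l0 negbK.
- by move=> r0; move: okr; rewrite r0 negbK.
Qed.

End Minimal.
End MinimalStructure.

(** * Transfer of m-connection *)

Section Windows.
Variable V : finType.
Implicit Types (G H : mgraph V) (i j k a b c x y : V) (C S Z : {set V}) (u v : nat -> V).

Definition window v n t m u : Prop :=
  (m < t /\ u = lwin v t m) \/ (t + m.+1 <= n /\ u = rwin v t m).

Lemma window_last v n t m u : window v n t m u -> u m.+1 = v t.
Proof. by case=> -[h ->]; rewrite /lwin /rwin; congr v; nlia. Qed.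

Lemma window_inner v n t m u s : window v n t m u -> 0 < t < n -> s < m ->
  exists r, [/\ 0 < r < n, u s.+1 = v r &
    forall G, collider G (u s) (u s.+1) (u s.+2) =
              collider G (v r.-1) (v r) (v r.+1)].
Proof.
case=> -[h ->] tn sm; rewrite /lwin /rwin.
  exists (t - m.+1 + s.+1); split=> [||G]; [by nlia|by []|].
  by rewrite !addnS.
exists (t + m.+1 - s.+1); split=> [||G]; [by nlia|by []|].
by rewrite collider_sym; congr (collider _ (v _) _ (v _)); nlia.
Qed.

Variables (G : mgraph V) (Z : {set V}).
Hypothesis Ganc : ancestral G.

Lemma minimal_triple_window n v t : minimal_walk G (ndesc G) Z n v -> 0 < t < n ->
  exists m u j, [/\ window v n t m u, disc G Z u m j &
    forall G', collider G' (u m) (u m.+1) j = collider G' (v t.-1) (v t) (v t.+1)].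
Proof.
move=> vmin tn; case: (minimal_triple Ganc vmin tn) => -[m [tm dm]].
  exists m, (lwin v t m), (v t.+1); split=> // [|G']; first by left.
  by rewrite /lwin; congr (collider _ (v _) (v _) _); nlia.
exists m, (rwin v t m), (v t.-1); split=> // [|G']; first by right.
by rewrite collider_sym /rwin; congr (collider _ _ (v _) (v _)); nlia.
Qed.

Lemma minimal_child_window n v t c : minimal_walk G (ndesc G) Z n v -> 0 < t < n ->
  collider G (v t.-1) (v t) (v t.+1) -> dedge G (v t) c -> c \in anc G Z ->
  exists m u, [/\ window v n t m u, disc G Z u m c &
    forall G', collider G' (v t.-1) (v t) (v t.+1) -> into G' (u m) (u m.+1)].
Proof.
move=> vmin tn tcol tc cZ.
case: (minimal_child Ganc vmin tn tcol tc cZ) => -[m [tm dm]].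
  exists m, (lwin v t m); split=> // [|G' /andP[+ _]]; first by left.
  by congr (into _ (v _) (v _)); rewrite /lwin; nlia.
exists m, (rwin v t m); split=> // [|G' /andP[_]]; first by right.
by congr (into _ (v _) (v _)); rewrite /rwin; nlia.
Qed.

End Windows.

Section ShortestChain.
Variable V : finType.
Implicit Types (G H : mgraph V) (a b k c : V) (Z : {set V}).

Definition shortest_to G Z k (p : seq V) : Prop :=
  [/\ path (dedge G) k p, last k p \in Z &
      forall q, path (dedge G) k q -> last k q \in Z -> size p <= size q].

Lemma shortest_to_exists G Z k : k \in anc G Z -> exists p, shortest_to G Z k p.
Proof.
case/ancP => s sZ /connectP[p kp sE].
pose P d := `[< exists q, [/\ path (dedge G) k q, last k q \in Z & size q = d] >].
have exP : exists d, P d.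
  by exists (size p); apply/asboolP; exists p; rewrite -sE.
case: (ex_minnP exP) => d /asboolP[q [kq lq sq]] dmin.
exists q; split=> // q' kq' lq'; rewrite sq; apply: dmin; apply/asboolP.
by exists q'.
Qed.

Lemma shortest_to_tail G Z k c p : shortest_to G Z k (c :: p) -> shortest_to G Z c p.
Proof.
case=> /= /andP[kc cp] lp pmin; split=> // q cq lq.
by have := pmin (c :: q); rewrite /= kc => /(_ cq lq).
Qed.

Lemma shortest_to_anc G Z k c p : shortest_to G Z k (c :: p) -> c \in anc G Z.
Proof.
case/shortest_to_tail => cp lp _; apply/ancP; exists (last c p) => //.
by apply/connectP; exists p.
Qed.

Lemma shortest_to_unshielded G Z k c c' p : ancestral G ->
  shortest_to G Z k [:: c, c' & p] -> k != c' /\ ~~ adj G k c'.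
Proof.
move=> Ganc [/= /and3P[kc cc' cp] lp pmin]; split.
  apply/eqP => kE; have := dedge_nconnect Ganc kc.
  by rewrite kE (connect1 cc').
apply/negP => kc'; have := pmin (c' :: p); rewrite /= cp lp.
by rewrite (dedge_trans Ganc kc cc' kc') ltnn => /(_ isT isT).
Qed.

(** Consecutive triples of a shortest directed path are unshielded, so the orientation of its first
    edge in [H] propagates along it. *)
Lemma shortest_to_transfer G H Z k c p : ancestral G ->
  (forall a k b, dedge G a k -> dedge G k b -> a != b -> ~~ adj G a b ->
     dedge H a k -> dedge H k b) ->
  shortest_to G Z k (c :: p) -> dedge H k c -> k \in anc H Z.
Proof.
move=> Ganc tr; elim: p k c => [|c' p IH] k c sp kc.
  by case: sp => _ /= cZ _; apply: anc_dedge kc _; apply: anc_self.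
apply: anc_dedge (kc) (IH c c' (shortest_to_tail sp) _).
have [kc' nkc'] := shortest_to_unshielded Ganc sp.
by case: sp => /= /and3P[kcG cc' _] _ _; apply: tr kc.
Qed.

End ShortestChain.

Section Discriminating.
Variable V : finType.
Implicit Types (G H : mgraph V) (i j k a b c x y : V) (C S Z : {set V}) (u v : nat -> V).

(** As [u 1, ..., u m] are colliders in [S], the path can only be blocked at [u m.+1]: a blocked
    non-collider is in [S], a blocked collider is not. *)
Lemma separated_end G S u m j : ancestral G ->
  (forall t, t <= m -> adj G (u t) (u t.+1)) ->
  (forall t, t < m -> collider G (u t) (u t.+1) (u t.+2) /\ u t.+1 \in S) ->
  adj G (u m.+1) j -> u 0 != j -> ~ m_connected G S (u 0) j ->
  (u m.+1 \in S) = ~~ collider G (u m) (u m.+1) j.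
Proof.
move=> Ganc uadj ugood mj uj nc.
pose w t := if t <= m.+1 then u t else j.
have wE t : t <= m.+1 -> w t = u t by rewrite /w => ->.
have wj : w m.+2 = j by rewrite /w ltnn.
have nok : ~~ triple_ok G (anc G S) S (u m) (u m.+1) j.
  apply/negP => ok; apply: nc; rewrite -wj -(wE 0) //.
  apply: walk_m_connected => //; last by rewrite wj wE.
  split=> t tm.
    have [->|tm'] := eqVneq t m.+1; first by rewrite wj wE.
    by rewrite !wE; [apply: uadj|..]; nlia.
  have [->|tm'] := eqVneq t m; first by rewrite wj !wE.
  rewrite !wE; [|nlia..]; rewrite /triple_ok; have [|-> ?] := ugood t; first by nlia.
  exact: anc_self.
move: nok; rewrite /triple_ok; case: ifP => _; last by rewrite negbK.
by move=> nS; apply: contraNF nS; apply: anc_self.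
Qed.

(** By induction along the path: stopped at [u t.+1] and continued to [j], it has the parent
    [u t.+1] of [j] as a non-collider, and [separated_end] applies. *)
Lemma disc_separated G Z S u m j : ancestral G -> disc G Z u m j ->
  ~ m_connected G S (u 0) j -> forall t, t < m -> u t.+1 \in S.
Proof.
move=> Ganc [uadj good mj uj nuj] nc.
elim/ltn_ind => t IH tm; have [_ _ tj] := good t tm.
rewrite (separated_end (j := j) Ganc) ?dedge_adj //.
- by rewrite /collider negb_and (dedge_ninto Ganc tj) orbT.
- by move=> s st; apply: uadj; nlia.
- move=> s st; split; last by apply: IH; nlia.
  by case: (good s) => //; nlia.
Qed.

Lemma disc_neighbour G Z u m j : disc G Z u m j ->
  exists2 k, adj G (u 0) k & adj G k j.
Proof.
case=> uadj good mj _ _; exists (u 1); first exact: uadj.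
by case: m uadj good mj => // m uadj good _; apply: dedge_adj; case: (good 0 isT).
Qed.

Section Transfer.
Variables (G H : mgraph V).
Hypothesis (Ganc : ancestral G) (Gmax : maximal G) (Hanc : ancestral H).
Hypothesis adjGH : forall a b, adj G a b = adj H a b.
Hypothesis sepGH : forall i k j, i != j -> ~~ adj G i j -> adj G i k -> adj G k j ->
  exists S, ~ m_connected G S i j /\ ~ m_connected H S i j.

(** In both graphs the status of [u m.+1] is read off from its membership in one common separating
    set. *)
Lemma disc_transfer Z u m j : disc G Z u m j ->
  (forall t, t < m -> collider H (u t) (u t.+1) (u t.+2)) ->
  collider H (u m) (u m.+1) j = collider G (u m) (u m.+1) j.
Proof.
move=> d Hcol; have [k ik kj] := disc_neighbour d.
have [uadj good mj uj nuj] := d.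
have [S [nG nH]] := sepGH uj nuj ik kj.
have uS := disc_separated Ganc d nG.
apply: negb_inj; rewrite -(separated_end (S := S) Ganc) //; last first.
  by move=> t tm; split; [case: (good t tm)|apply: uS].
rewrite -(separated_end (S := S) Hanc) -?adjGH // => t tm.
  by rewrite -adjGH; apply: uadj.
by split; [apply: Hcol|apply: uS].
Qed.

Lemma dedge_transfer a k b : dedge G a k -> dedge G k b -> a != b -> ~~ adj G a b ->
  dedge H a k -> dedge H k b.
Proof.
move=> ak kb ab nab Hak.
have d : disc G finset.set0 (fun t => if t is 0 then a else k) 0 b.
  by split=> //= [[|t]//|]; rewrite ?dedge_adj.
have E : collider H a k b = collider G a k b by apply: (disc_transfer d).
have : ~~ collider G a k b by rewrite /collider negb_and (dedge_ninto Ganc kb) orbT.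
rewrite -E (ncollider_out Hanc) -?adjGH ?dedge_adj // => /orP[/(dedge_ninto Hanc)|//].
by rewrite /into Hak.
Qed.

Section Mismatch.
Variables (Z : {set V}) (n : nat) (v : nat -> V).
Hypothesis vmin : minimal_walk G (ndesc G) Z n v.

Let mismatch t : bool :=
  [&& 0 < t < n, collider G (v t.-1) (v t) (v t.+1) & ~~ collider H (v t.-1) (v t) (v t.+1)].

(** The left window of [t] and the right window of [s] overlap. If the latter has inner vertices
    past [t], then [v s -> v t.+1 -> v s.-1] contradicts the arrowhead at [v s]. Otherwise the
    stretch from [v s.-1] to [v t.+1] is an inducing path between non-adjacent vertices, against
    maximality. *)
Lemma two_cycle s t m m' : s < t -> 0 < s -> t < n ->
  t - m <= s -> m < t -> disc G Z (lwin v t m) m (v t.+1) ->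
  t <= s + m' -> s + m'.+1 <= n -> disc G Z (rwin v s m') m' (v s.-1) -> False.
Proof.
move=> st s0 tn ts mt [_ goodL _ _ _] ts' sn [_ goodR _ uR nuR].
have gL r : t - m <= r < t -> collider G (v r.-1) (v r) (v r.+1) /\ dedge G (v r) (v t.+1).
  move=> /andP[tr rt]; have [|+ _] := goodL (r - (t - m)); first by nlia.
  rewrite /lwin; have -> : t - m.+1 + (r - (t - m)) = r.-1 by nlia.
  have -> : t - m.+1 + (r - (t - m)).+1 = r by nlia.
  by have -> : t - m.+1 + (r - (t - m)).+2 = r.+1 by nlia.
have gR r : s < r <= s + m' -> collider G (v r.-1) (v r) (v r.+1) /\ dedge G (v r) (v s.-1).
  move=> /andP[sr rs]; have [|+ _] := goodR (s + m' - r); first by nlia.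
  rewrite /rwin collider_sym; have -> : s + m'.+1 - (s + m' - r) = r.+1 by nlia.
  have -> : s + m'.+1 - (s + m' - r).+1 = r by nlia.
  by have -> : s + m'.+1 - (s + m' - r).+2 = r.-1 by nlia.
have [sC sD] : collider G (v s.-1) (v s) (v s.+1) /\ dedge G (v s) (v t.+1).
  by apply: gL; nlia.
have [ts1|ts1] := leqP t.+1 (s + m').
  have [_ tD] : collider G (v t) (v t.+1) (v t.+2) /\ dedge G (v t.+1) (v s.-1).
    by apply: (gR t.+1); nlia.
  have /andP[i_s _] := sC; have /negP[] := into_nconnect Ganc i_s.
  by apply: connect_trans (connect1 tD); apply: connect1.
have tE : t = s + m' by nlia.
move: uR nuR; rewrite /rwin subn0 addnS -tE => uR nuR.
have ne : v s.-1 != v t.+1 by rewrite eq_sym.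
have nadj : ~~ adj G (v s.-1) (v t.+1) by rewrite adj_sym.
have [S _ []] := Gmax ne nadj.
have vadj := vmin.1.1.
pose l := (t.+1 - s.-1)%N.
have e : s.-1 + l = t.+1 by rewrite /l; nlia.
have := @inducing_m_connected _ _ Ganc S l (fun r => v (s.-1 + r)).
rewrite addn0 e; apply=> // r rl; rewrite ?addnS.
- by apply: vadj; rewrite /l in rl; nlia.
- have := rl; rewrite /l => rl'; have [rt|rt] := ltnP (s + r) t.
    have [] := gL (s + r); first by nlia.
    by rewrite (_ : s + r = (s.-1 + r).+1) //; nlia.
  have [] := gR (s + r); first by nlia.
  by rewrite (_ : s + r = (s.-1 + r).+1) //; nlia.
- have := rl; rewrite /l => rl'; have [rt|rt] := ltnP (s + r) t.
    have [] := gL (s + r); first by nlia.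
    rewrite (_ : s + r = (s.-1 + r).+1); last by nlia.
    by move=> _ /connect1 c; rewrite anc2 c orbT.
  have [] := gR (s + r); first by nlia.
  rewrite (_ : s + r = (s.-1 + r).+1); last by nlia.
  by move=> _ /connect1 c; rewrite anc2 c.
Qed.

Let leftward t := [/\ mismatch t & exists m, [/\ m < t, disc G Z (lwin v t m) m (v t.+1) &
  exists s, [/\ t - m <= s, s < t & mismatch s]]].

Let rightward t := [/\ mismatch t & exists m, [/\ t + m.+1 <= n,
  disc G Z (rwin v t m) m (v t.-1) & exists s, [/\ t < s, s <= t + m & mismatch s]]].

(** If [G] and [H] agreed on the inner vertices of the window, [disc_transfer] would make them agree
    at [t]. *)
Lemma mismatch_direction t : mismatch t -> leftward t \/ rightward t.
Proof.
move=> mt; have /and3P[tn cG cH] := mt.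
have transfer m u j : disc G Z u m j ->
    collider G (u m) (u m.+1) j -> ~~ collider H (u m) (u m.+1) j ->
    exists r, r < m /\ ~~ collider H (u r) (u r.+1) (u r.+2).
  move=> d c nc; apply: contrapT => none; case/negP: nc; rewrite (disc_transfer d) // => r rm.
  by apply: contrapT => /negP nc; apply: none; exists r.
case: (minimal_triple Ganc vmin tn) => -[m [tm d]]; [left|right]; split=> //;
  exists m; split=> //.
  have e1 : t - m.+1 + m = t.-1 by nlia.
  have e2 : t - m.+1 + m.+1 = t by nlia.
  have := transfer _ _ _ d; rewrite /lwin e1 e2 => /(_ cG cH)[r [rm nc]].
  have [_ good _ _ _] := d; have [+ _ _] := good r rm.
  rewrite /lwin; set s := t - m.+1 + r.+1 => cr.
  have e3 : t - m.+1 + r = s.-1 by rewrite /s; nlia.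
  have e4 : t - m.+1 + r.+2 = s.+1 by rewrite /s; nlia.
  rewrite e3 e4 in nc cr; exists s; rewrite /mismatch nc cr /s.
  by split; rewrite ?andbT; nlia.
have e1 : t + m.+1 - m = t.+1 by nlia.
have e2 : t + m.+1 - m.+1 = t by nlia.
have := transfer _ _ _ d; rewrite /rwin e1 e2 ![collider _ (v t.+1) _ _]collider_sym.
move=> /(_ cG cH)[r [rm nc]].
have [_ good _ _ _] := d; have [+ _ _] := good r rm.
rewrite /rwin; set s := t + m.+1 - r.+1 => cr.
have e3 : t + m.+1 - r = s.+1 by rewrite /s; nlia.
have e4 : t + m.+1 - r.+2 = s.-1 by rewrite /s; nlia.
rewrite e3 e4 ![collider _ (v s.+1) _ _]collider_sym in nc cr.
exists s; rewrite /mismatch nc cr /s.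
by split; rewrite ?andbT; nlia.
Qed.

(* The nearest mismatch below a leftward one would be rightward, closing a
   forbidden two-cycle. *)
Lemma not_leftward t : ~ leftward t.
Proof.
elim/ltn_ind: t => t IH [mt [m [mlt d [s0 [ts0 s0t ms0]]]]].
have exP : exists s, (s < t) && mismatch s by exists s0; rewrite s0t.
have ubP s : (s < t) && mismatch s -> s <= t by case/andP => /ltnW.
case: (ex_maxnP exP ubP) => s /andP[st ms] smax.
have s0s : s0 <= s by apply: smax; rewrite s0t.
case: (mismatch_direction ms) => [/IH|[_ [m' [sn d' [r [sr rs mr]]]]]]; first exact.
(* The mismatch [r] lies beyond [s], the last one below [t], so the window of [s] reaches [t]. *)
have tr : t <= r.
  by rewrite leqNgt; apply/negP => rt; have := smax r; rewrite rt mr => /(_ isT); nlia.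
have /andP[s_gt0 _] : 0 < s < n by case/and3P: ms.
have /andP[_ tn] : 0 < t < n by case/and3P: mt.
by apply: (two_cycle st s_gt0 tn _ mlt d _ sn d'); nlia.
Qed.

Lemma no_mismatch t : mismatch t = false.
Proof.
apply/negP; have [d] := ubnP (n - t); elim: d t => // d IH t td mt.
case: (mismatch_direction mt) => [/not_leftward //|[_ [m [_ _ [s [ts _ ms]]]]]].
have /and3P[tn _ _] := mt.
by apply: IH ms; nlia.
Qed.

Lemma window_collider_transfer t m u j : 0 < t < n -> window v n t m u -> disc G Z u m j ->
  collider H (u m) (u m.+1) j = collider G (u m) (u m.+1) j.
Proof.
move=> tn win d; apply: (disc_transfer d) => r rm.
have [_ good _ _ _] := d; have [c _ _] := good r rm.
have [s [sn _ E]] := window_inner win tn rm.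
have := no_mismatch s; rewrite /mismatch sn -!E c /=; exact: negbFE.
Qed.

Lemma collider_transfer t : 0 < t < n ->
  collider H (v t.-1) (v t) (v t.+1) = collider G (v t.-1) (v t) (v t.+1).
Proof.
move=> tn; have [m [u [j [win d E]]]] := minimal_triple_window Ganc vmin tn.
by rewrite -!E; apply: window_collider_transfer win d.
Qed.

(** Let [c] follow [v t] on a shortest directed path to [Z]. On the window towards [c], [v t] is a
    non-collider in both graphs; having an arrowhead from the walk in [H], it points to [c]
    there. *)
Lemma collider_anc_transfer t : 0 < t < n -> collider G (v t.-1) (v t) (v t.+1) ->
  v t \in anc G Z -> v t \in anc H Z.
Proof.
move=> tn tcol /shortest_to_exists[[|c p] sp].
  by case: sp => _ /= tZ _; apply: anc_self.
have tc : dedge G (v t) c by case: sp => /= /andP[].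
have cZ := shortest_to_anc sp.
have [m [u [win d i]]] := minimal_child_window Ganc vmin tn tcol tc cZ.
apply: (shortest_to_transfer Ganc dedge_transfer sp).
have := window_collider_transfer tn win d.
rewrite /collider i ?collider_transfer //= (window_last win) (dedge_ninto Ganc tc) andbF.
by move=> nci; apply: ninto_dedge; rewrite ?nci // -adjGH adj_sym dedge_adj.
Qed.

End Mismatch.

Lemma m_connected_transfer Z x y : x != y -> m_connected G Z x y -> m_connected H Z x y.
Proof.
move=> xy /m_connected_walk[n0 [v0 [vw0 vx0 vy0 _]]].
have [n [v [vmin vx vy]]] := minimal_walk_exists (ndesc G) vw0.
rewrite -vx0 -vy0 -vx -vy in xy *; apply: walk_m_connected => //.
have [[vadj vok] _] := vmin; split=> t tn; first by rewrite -adjGH; apply: vadj.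
have tn1 : 0 < t.+1 < n by [].
have := vok t tn; rewrite /triple_ok (collider_transfer vmin tn1) /=.
by case: ifP => // c; apply: (collider_anc_transfer vmin tn1).
Qed.

End Transfer.
End Discriminating.

(** * Orientation along a poset *)

Section PosetOrientation.
Variable V : finType.
Implicit Types (i j k a b c : V) (S Z W : {set V}) (u v : nat -> V).
Variables (G H : mgraph V) (le : rel V).
Hypothesis (Ganc : ancestral G) (Hanc : ancestral H).
Hypothesis adjGH : forall a b, adj G a b = adj H a b.
Hypothesis (le_anti : antisymmetric le) (le_trans : transitive le).
Hypothesis dedgeH : forall a b, dedge H a b = adj H a b && le a b.
Hypothesis sepG : forall i k j, i != j -> ~~ adj G i j -> adj G i k -> adj G k j ->
  ~ m_connected G (pre le i j :\: [set i; j]) i j.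

Lemma disc_le Z u m j : disc G Z u m j ->
  (forall t, t < m -> le (u t.+1) (u 0) || le (u t.+1) j) /\
  le (u m.+1) (u 0) || le (u m.+1) j = ~~ collider G (u m) (u m.+1) j.
Proof.
move=> d; have [k ik kj] := disc_neighbour d; have [uadj good mj uj nuj] := d.
have nS := sepG uj nuj ik kj; have uS := disc_separated Ganc d nS.
split=> [t /uS|]; first by rewrite !inE => /andP[].
rewrite -(separated_end Ganc uadj _ mj uj nS).
  rewrite !inE (negbTE (adj_neq mj)) orbF.
  by have -> : u m.+1 == u 0 = false by apply: contraTF mj => /eqP->.
by move=> t tm; split; [case: (good t tm)|apply: uS].
Qed.

Lemma dedge_orient a k b : dedge G a k -> dedge G k b -> a != b -> ~~ adj G a b ->
  dedge H a k -> dedge H k b.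
Proof.
move=> ak kb ab nab; have d : disc G finset.set0 (fun t => if t is 0 then a else k) 0 b.
  by split=> //= [[|t]//|]; rewrite ?dedge_adj.
have [_] := disc_le d; rewrite /= /collider (dedge_ninto Ganc kb) andbF /=.
rewrite !dedgeH -!adjGH (dedge_adj ak) (dedge_adj kb) /= => /orP[ka ak'|//].
have kE := le_anti (introT andP (conj ka ak')).
by have := adj_neq (dedge_adj ak); rewrite kE eqxx.
Qed.

Section Walk.
Variables (Z : {set V}) (n : nat) (v : nat -> V).
Hypothesis vmin : minimal_walk G (ndesc G) Z n v.

Definition below_left t : Prop :=
  exists s, [/\ s < t, forall r, s < r < t -> v r \in Z & le (v t) (v s)].
Definition below_right t : Prop :=
  exists s, [/\ t < s <= n, forall r, t < r < s -> v r \in Z & le (v t) (v s)].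

Lemma window_below t m u j : 0 < t < n -> window v n t m u -> disc G Z u m j ->
  le (v t) (u 0) -> below_left t \/ below_right t.
Proof.
move=> tn win [_ good _ _ _] lt; case: win => -[h uE]; subst u; [left|right].
  exists (t - m.+1); split; [nlia| |by rewrite /lwin addn0 in lt].
  move=> r rt; have [|_ + _] := good (r - (t - m)); first by nlia.
  by rewrite /lwin; have -> : t - m.+1 + (r - (t - m)).+1 = r by nlia.
exists (t + m.+1); split; [nlia| |by rewrite /rwin subn0 in lt].
move=> r rt; have [|_ + _] := good (t + m - r); first by nlia.
by rewrite /rwin; have -> : t + m.+1 - (t + m - r).+1 = r by nlia.
Qed.

(** A collider of [G] is below neither end of its window. An edge of [H] out of it would put it
    below [j] or below [u m], which is an end or lies below one. *)
Lemma collider_orient t : 0 < t < n -> collider G (v t.-1) (v t) (v t.+1) ->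
  collider H (v t.-1) (v t) (v t.+1).
Proof.
move=> tn; have [m [u [j [win d E]]]] := minimal_triple_window Ganc vmin tn.
rewrite -!E => cG; have [uS] := disc_le d; rewrite cG => /norP[ki kj].
have [uadj _ mj _ _] := d.
apply: contraT; rewrite (ncollider_out Hanc) -?adjGH ?uadj // !dedgeH.
case/orP => /andP[_ kle]; last by rewrite kle in kj.
case: m {E win d uadj mj cG} uS ki kj kle => [_ /negbTE->//|m uS /negbTE ki /negbTE kj kle].
by case/orP: (uS m (leqnn _)) => /(le_trans kle); rewrite ?ki ?kj.
Qed.

(** A non-collider of [G] lies below an end of its window; were it below [j], its edge to [j] would
    leave it in [H]. *)
Lemma ncollider_orient t : 0 < t < n -> ~~ collider G (v t.-1) (v t) (v t.+1) ->
  collider H (v t.-1) (v t) (v t.+1) -> below_left t \/ below_right t.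
Proof.
move=> tn; have [m [u [j [win d E]]]] := minimal_triple_window Ganc vmin tn.
rewrite -!E => nc cH; have [_] := disc_le d; rewrite nc => /orP[ki|kj].
  by apply: (window_below tn win d); rewrite -(window_last win).
have [_ _ mj _ _] := d; have kjH : dedge H (u m.+1) j by rewrite dedgeH kj -adjGH mj.
by move: cH; rewrite /collider (dedge_ninto Hanc kjH) andbF.
Qed.

(** The window towards the next vertex [c] of a shortest directed path to [Z] puts [v t] below [u 0]
    or below [c]; in the latter case the path transfers to [H]. *)
Lemma collider_anc_orient t : 0 < t < n -> collider G (v t.-1) (v t) (v t.+1) ->
  v t \in anc H Z \/ (below_left t \/ below_right t).
Proof.
move=> tn tcol; have [vt|/negP vt] := boolP (v t \in anc G Z); last first.
  case: vt; have [[vadj vok] _] := vmin; have := vok t.-1.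
  by rewrite prednK; [rewrite /triple_ok tcol; apply; nlia|nlia].
have [[|c p] sp] := shortest_to_exists vt.
  by left; case: sp => _ /= tZ _; apply: anc_self.
have tc : dedge G (v t) c by case: sp => /= /andP[].
have cZ := shortest_to_anc sp.
have [m [u [win d i]]] := minimal_child_window Ganc vmin tn tcol tc cZ.
have [_] := disc_le d; rewrite (window_last win).
rewrite {1}/collider (dedge_ninto Ganc tc) andbF /= => /orP[ki|kj].
  by right; exact: (window_below tn win d ki).
left; apply: (shortest_to_transfer Ganc dedge_orient sp).
by rewrite dedgeH kj -adjGH dedge_adj.
Qed.

End Walk.

(* Cut a minimal walk into its maximal segments outside W.  Each contains an
   H-collider, which must sit at an end of the segment and lie below the nearest
   vertex of the adjacent segment; so two facing ends lie below one another. *)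
Lemma down_set_separated W a b : a \in W -> b \in W -> a != b -> ~~ adj G a b ->
  (forall c k, le c k -> k \in W -> c \in W) ->
  (forall c, c \in W -> adj G c b -> dedge H c b) ->
  ~ m_connected G (W :\: [set a; b]) a b.
Proof.
move=> aW bW ab nab down sink; set Z := W :\: _.
move=> /m_connected_walk[n0 [v0 [vw0 vx0 vy0 _]]].
have [n [v [vmin vx vy]]] := minimal_walk_exists (ndesc G) vw0.
rewrite vx0 in vx; rewrite vy0 in vy.
have vinj := minimal_walk_inj Ganc (@ndesc_gt0 V G) vmin.
have [[vadj vok] _] := vmin.
have vadjH t : t < n -> adj H (v t) (v t.+1) by move=> tn; rewrite -adjGH; apply: vadj.
have dirW c k : dedge H c k -> k \in W -> c \in W.
  by rewrite dedgeH => /andP[_ ck]; apply: down ck.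
have ZW r : v r \in Z -> v r \in W by case/setDP.
(* Interior vertices in [W] lie in the conditioning set, so they are colliders of [G], hence of
   [H]. *)
have inner t : 0 < t < n -> v t \in W -> collider H (v t.-1) (v t) (v t.+1).
  move=> tn tW; apply: (collider_orient vmin tn); apply: contraT => nc.
  have t1 : t.-1.+1 = t by nlia.
  have := vok t.-1; rewrite t1 /triple_ok (negbTE nc); have /andP[_ tn'] := tn.
  move/(_ tn').
  have na : v 0 != v t by apply: vinj; nlia.
  have nb : v t != v n by apply: vinj; nlia.
  by rewrite finset.in_setD tW finset.in_set2 -vx -vy eq_sym (negbTE na) (negbTE nb).
have outer t : 0 < t < n -> v t \notin W -> collider H (v t.-1) (v t) (v t.+1) ->
    below_left Z v t \/ below_right Z n v t.
  move=> tn tW cH; have [cG|nc] := boolP (collider G (v t.-1) (v t) (v t.+1)).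
    case: (collider_anc_orient vmin tn cG) => // /ancP[s /setDP[sW _] /connectP[p tp sE]].
    case/negP: tW; elim: p (v t) tp sE => [|c p IH] k /=; first by move=> _ <-.
    by case/andP=> kc cp sE; apply: dirW kc _; apply: IH.
  exact: (ncollider_orient vmin tn nc cH).
(* Follow directed edges of [H] up to the first collider; they cannot enter the down-set [W], hence
   do not reach [b]. *)
have segment s : 0 < s < n -> v s \notin W -> into H (v s.-1) (v s) ->
    exists r, [/\ s <= r < n, forall x, s <= x <= r -> v x \notin W &
                 collider H (v r.-1) (v r) (v r.+1)].
  have [d] := ubnP (n - s); elim: d s => // d IH s sd sn sW is_.
  have [c|nc] := boolP (collider H (v s.-1) (v s) (v s.+1)).
    exists s; split=> //; first by nlia.
    by move=> x xs; have -> : x = s by nlia.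
  have ss : dedge H (v s) (v s.+1).
    apply: ninto_dedge; first by rewrite adj_sym; apply: vadjH; nlia.
    by apply: contra nc => i; rewrite /collider is_ i.
  have s1W : v s.+1 \notin W by apply: contra sW; apply: dirW ss.
  have s1n : s.+1 < n.
    have /andP[_] := sn; rewrite leq_eqVlt => /predU1P[sE|//].
    by move: s1W; rewrite sE vy bW.
  have [||||r [sr rW c]] := IH s.+1 => //; first by nlia.
    by rewrite /into ss.
  exists r; split=> //; first by nlia.
  move=> x xr; have [->//|xs] := eqVneq x s; apply: rW; nlia.
(* If [s] were [t.-1], the collider [v t] would point to [v s] in [H]; so [v t.-1] is one of the
   vertices of [Z] in between. *)
have left_end t : 0 < t < n -> v t \notin W -> collider H (v t.-1) (v t) (v t.+1) ->
    below_left Z v t -> v t.-1 \in W /\ exists s, [/\ s < t, v s \notin W,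
      forall r, s < r < t -> v r \in W & le (v t) (v s)].
  move=> tn tW cH [s [st sZ ts]]; have sW : v s \notin W by apply: contra tW; apply: down ts.
  split; last by exists s; split=> // r /sZ/ZW.
  apply: ZW; apply: sZ; have [sE|sE] := eqVneq s t.-1; last by nlia.
  have /vadjH : t.-1 < n by nlia.
  rewrite prednK -?sE; last by nlia.
  rewrite adj_sym => a_ts; have : dedge H (v t) (v s) by rewrite dedgeH a_ts ts.
  by move/(dedge_ninto Hanc); move: cH; rewrite -sE /collider => /andP[->].
have right_end t : 0 < t < n -> v t \notin W -> collider H (v t.-1) (v t) (v t.+1) ->
    below_right Z n v t -> v t.+1 \in W /\ exists s, [/\ t < s < n, v s \notin W,
      forall r, t < r < s -> v r \in W & le (v t) (v s)].
  move=> tn tW cH [s [/andP[ts sn] sZ lts]].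
  have sW : v s \notin W by apply: contra tW; apply: down lts.
  have s_lt : s < n.
    by rewrite ltn_neqAle sn andbT; apply: contra sW => /eqP->; rewrite vy.
  split; last by exists s; split=> [|//|r /sZ/ZW//|//]; rewrite ts.
  apply: ZW; apply: sZ; have [sE|sE] := eqVneq s t.+1; last by nlia.
  have /vadjH : t < n by nlia.
  rewrite -sE => a_ts; have : dedge H (v t) (v s) by rewrite dedgeH a_ts lts.
  by move/(dedge_ninto Hanc); move: cH; rewrite -sE /collider => /andP[_ ->].
have into_start s : 0 < s < n -> v s \notin W -> v s.-1 \in W -> into H (v s.-1) (v s).
  move=> sn sW s1W; apply: contraR sW => ni; apply: dirW s1W; apply: ninto_dedge ni.
  by have := vadjH s.-1; rewrite prednK; [apply; nlia|nlia].
pose Q t := [&& 0 < t < n, v t \notin W, collider H (v t.-1) (v t) (v t.+1) &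
             `[< below_right Z n v t >]].
have [exQ|nQ] := pselect (exists t, Q t).
  (* Take the last such [t]. The segment starting at its target [s] has a collider [r], which by
     maximality lies below a vertex to its left; this forces [r = s] with target [t]. *)
  have ubQ t : Q t -> t <= n by case/and4P => /andP[_ /ltnW].
  case: (ex_maxnP exQ ubQ) => t /and4P[tn tW tH /asboolP br] tmax.
  have [t1W [s [tsn sW tsW lts]]] := right_end t tn tW tH br.
  have st1 : s != t.+1 by apply: contraNneq sW => ->.
  have sn : 0 < s < n by nlia.
  have s1W : v s.-1 \in W by apply: tsW; nlia.
  have [r [sr rW rH]] := segment s sn sW (into_start s sn sW s1W).
  have rn : 0 < r < n by nlia.
  have rW' : v r \notin W by apply: rW; nlia.
  have rbl : below_left Z v r.
    case: (outer r rn rW' rH) => // /asboolP rbr.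
    by have := tmax r; rewrite /Q rn rW' rH rbr => /(_ isT); nlia.
  have [r1W [q [qr qW qrW lrq]]] := left_end r rn rW' rH rbl.
  have rs : r = s.
    have [//|rs] := eqVneq r s; have : v r.-1 \notin W by apply: rW; nlia.
    by rewrite r1W.
  subst r; have qt : q = t.
    have [//|qt] := eqVneq q t; exfalso; have [qt'|qt'] := ltnP q t.
      by case/negP: tW; apply: qrW; nlia.
    by case/negP: qW; apply: tsW; nlia.
  subst q; have : v t != v s by apply: vinj; nlia.
  by rewrite (le_anti (introT andP (conj lts lrq))) eqxx.
have nbr t : 0 < t < n -> v t \notin W -> collider H (v t.-1) (v t) (v t.+1) ->
    below_left Z v t.
  move=> tn tW tH; case: (outer t tn tW tH) => // /asboolP br.
  by case: nQ; exists t; rewrite /Q tn tW tH br.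
have n2 : 1 < n.
  rewrite ltnNge; apply/negP => n1; have [n0E|n_gt0] := posnP n.
    by rewrite -vx -vy n0E eqxx in ab.
  have nE : n = 1 by nlia.
  by move: nab; rewrite -vx -vy nE (vadj 0) // nE.
have n1 : 0 < n.-1 < n by nlia.
(* By [sink], a vertex of [W] just before [b] would point to [b] and so not be a collider of [H]. *)
have exO : exists s, (0 < s < n) && (v s \notin W).
  exists n.-1; rewrite n1 /=; apply/negP => n1W.
  have := inner _ n1 n1W; have e : n.-1.+1 = n by nlia.
  have a_b : adj G (v n.-1) b by rewrite -vy -{2}e; apply: vadj; nlia.
  by rewrite e vy /collider (dedge_ninto Hanc (sink _ n1W a_b)) andbF.
(* The collider of the first segment lies below a vertex outside [W] that comes before this segment,
   and there is none. *)
case: (ex_minnP exO) => s /andP[sn sW] smin.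
have s1W : v s.-1 \in W.
  have [s0|s0] := eqVneq s.-1 0; first by rewrite s0 vx.
  apply: contraT => s1W; have := smin s.-1; rewrite s1W andbT.
  have -> : 0 < s.-1 < n by nlia.
  by move/(_ isT); nlia.
have [r [sr rW rH]] := segment s sn sW (into_start s sn sW s1W).
have rn : 0 < r < n by nlia.
have rW' : v r \notin W by apply: rW; nlia.
have [r1W [q [qr qW qrW lrq]]] := left_end r rn rW' rH (nbr r rn rW' rH).
have rs : r = s.
  have [//|rs] := eqVneq r s; have : v r.-1 \notin W by apply: rW; nlia.
  by rewrite r1W.
subst r; have q0 : 0 < q.
  by rewrite lt0n; apply: contraNneq qW => ->; rewrite vx.
have := smin q; rewrite qW andbT; have -> : 0 < q < n by nlia.
by move/(_ isT); nlia.
Qed.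

End PosetOrientation.

(** * The graphs AG(pi, P) *)

Section Posets.
Variable V : finType.
Implicit Types (G H : mgraph V) (i j a b : V) (le : rel V).

Lemma mgraph_eq G H : dir G = dir H -> bid G = bid H -> G = H.
Proof.
case: G H => [d b hd hb] [d' b' hd' hb'] /= dE bE; subst d' b'.
by rewrite (bool_irrelevance hd hd') (bool_irrelevance hb hb').
Qed.

Lemma poE G i j : po G i j = connect (dedge G) i j.
Proof. by rewrite /po inE. Qed.

Lemma po_poset G : ancestral G -> is_poset (po G).
Proof.
move=> Ganc; split=> [a|a b|b a c]; rewrite !poE ?connect0 //.
  by case/andP; apply: connect_anti.
exact: connect_trans.
Qed.

Lemma preC le i j : pre le i j = pre le j i.
Proof. by apply/setP => c; rewrite !inE orbC. Qed.

Lemma pre_po G i j : pre (po G) i j = anc G [set i; j].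
Proof. by apply/setP => c; rewrite anc2 inE !poE. Qed.

End Posets.

Section AGraph.
Context {d : measure_display} {T : measurableType d} {R : realType}.
Variables (P : probability T R) (V : finType) (X : V -> {RV P >-> R}).
Implicit Types (G H : mgraph V) (i j k a b c : V) (S : {set V}) (le : rel V).

Lemma cond_indep_sym (A B C : {set V}) : cond_indep X A B C -> cond_indep X B A C.
Proof.
move=> AB E F EB FA e f g eE fF gEF.
have gFE : is_cond_prob P (events_of X C) (F `&` E)%classic g.
  by rewrite classical_sets.setIC.
have := AB F E FA EB f e g fF eE gFE.
by apply: filterS => t ->; rewrite GRing.mulrC.
Qed.

Lemma dependent_sym i j S : dependent X i j S -> dependent X j i S.
Proof. by apply: contra_not => /cond_indep_sym. Qed.

Lemma AG_dep_sym le i j : AG_dep X le i j = AG_dep X le j i.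
Proof.
by apply/asboolP/asboolP => /dependent_sym; rewrite preC finset.setUC.
Qed.

Lemma dedge_AG le i j : dedge (AG X le) i j = [&& i != j, le i j & AG_dep X le i j].
Proof. by rewrite /dedge inE. Qed.

Lemma bedge_AG le i j :
  bedge (AG X le) i j = [&& i != j, incomparable le i j & AG_dep X le i j].
Proof.
rewrite /bedge inE; apply/existsP/idP => [[a /existsP[b]]|ij].
  case/and4P=> /eqP/set2_eq[][-> ->] ab inc dep; first by rewrite ab inc dep.
  by rewrite eq_sym ab AG_dep_sym dep /incomparable andbC; case/andP: inc => -> ->.
by exists i; apply/existsP; exists j; rewrite eqxx.
Qed.

Lemma adj_AG le i j : adj (AG X le) i j = (i != j) && AG_dep X le i j.
Proof.
rewrite /adj !dedge_AG bedge_AG (AG_dep_sym _ j) (eq_sym j) /incomparable.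
by case: (i != j) (AG_dep X le i j) (le i j) (le j i) => [] [] [] [].
Qed.

Lemma dedge_AG_adj le i j : dedge (AG X le) i j = adj (AG X le) i j && le i j.
Proof. by rewrite dedge_AG adj_AG -andbA [AG_dep _ _ _ _ && _]andbC. Qed.

Lemma connect_AG le : is_poset le ->
  forall i j, connect (dedge (AG X le)) i j -> le i j.
Proof.
move=> [refl _ trans] i j /connectP[p]; elim: p i => [|k p IH] i /=; first by move=> _ ->.
by case/andP; rewrite dedge_AG => /and3P[_ ik _] kp jE; apply: trans ik (IH k kp jE).
Qed.

Lemma AG_ancestral le : is_poset le -> ancestral (AG X le).
Proof.
move=> lepo; have [_ anti _] := lepo; split=> [[//|a p] _|i j].
  apply/negP; rewrite /= rcons_path => /andP[ap].
  rewrite dedge_AG => /and3P[ne la _]; case/negP: ne; apply/eqP; apply: anti.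
  by rewrite la; apply: connect_AG => //; apply/connectP; exists p.
rewrite bedge_AG => /and3P[_ /andP[nij _] _].
by apply: contra nij; apply: connect_AG.
Qed.

Section Faithful.
Variable G : mgraph V.
Hypothesis (Gdmag : dmag G) (Gfaith : restricted_faithful X G).

Let Ganc : ancestral G := Gdmag.1.
Let Gmax : maximal G := Gdmag.2.

Lemma dependent_m_connected i j S : i != j -> S \subset ~: [set i; j] ->
  dependent X i j S -> m_connected G S i j.
Proof.
move=> ij; rewrite sub_setC2 => /andP[iS jS] dep; apply: contrapT => nc.
have [Gmarkov _ _ _] := Gfaith; apply: dep; apply: Gmarkov.
  by rewrite /pairwise_disjoint !disjoints1 finset.in_set1 ij iS jS.
by move=> a b /set1P-> /set1P->.
Qed.

Lemma sub_setD2 S i j : S :\: [set i; j] \subset ~: [set i; j].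
Proof. by rewrite finset.setDE finset.subsetIr. Qed.

Lemma adj_AG_faithful le i j : adj G i j -> adj (AG X le) i j.
Proof.
move=> ij; rewrite adj_AG (adj_neq ij); apply/asboolP.
by have [_ adj_dep _ _] := Gfaith; apply: adj_dep => //; apply: sub_setD2.
Qed.

(** Non-adjacent vertices are separated by their other ancestors, by maximality, hence conditionally
    independent. An edge of an ancestral graph is directed exactly when its ends are comparable in
    [po G]. *)
Lemma AG_po : AG X (po G) = G.
Proof.
have adjE i j : adj (AG X (po G)) i j = adj G i j.
  apply/idP/idP; last exact: adj_AG_faithful.
  rewrite adj_AG => /andP[ij /asboolP]; rewrite pre_po => dep.
  apply: contraT => nij; exfalso; apply: (maximal_separated Ganc Gmax ij nij).
  by apply: dependent_m_connected dep => //; apply: sub_setD2.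
have dedgeE i j : dedge (AG X (po G)) i j = dedge G i j.
  rewrite dedge_AG_adj adjE poE; apply/andP/idP => [[ij c]|ij].
    apply: ninto_dedge; first by rewrite adj_sym.
    by apply: contraTN c => /(into_nconnect Ganc).
  by rewrite dedge_adj ?connect1.
have bedgeE i j : bedge (AG X (po G)) i j = bedge G i j.
  have H A : ancestral A -> bedge A i j = [&& adj A i j, ~~ dedge A i j & ~~ dedge A j i].
    move=> Aanc; apply/idP/and3P => [ij|[+ /negbTE ij /negbTE ji]].
      split; first exact: bedge_adj.
        by apply/negP => /connect1; apply/negP/Aanc.2.
      by apply/negP => /connect1; apply/negP/Aanc.2; rewrite bedge_sym.
    by rewrite /adj ij ji.
  by rewrite !H ?adjE ?dedgeE //; apply/AG_ancestral/po_poset.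
apply: mgraph_eq; apply/setP; first by case=> i j; apply: dedgeE.
move=> e; apply/idP/idP => ein.
  have /cards2P[i [j [_ eE]]] := forall_inP (bid_card2 _) _ ein.
  by move: ein; rewrite eE; have := bedgeE i j; rewrite /bedge => ->.
have /cards2P[i [j [_ eE]]] := forall_inP (bid_card2 _) _ ein.
by move: ein; rewrite eE; have := bedgeE i j; rewrite /bedge => ->.
Qed.

Lemma nadj_AG_separated le i k j : i != j -> ~~ adj (AG X le) i j ->
  adj G i k -> adj G k j -> ~ m_connected G (pre le i j :\: [set i; j]) i j.
Proof.
move=> ij nij ik kj mc; case/negP: nij; rewrite adj_AG ij; apply/asboolP.
have [_ _ dist2 _] := Gfaith.
exact: dist2 ij ik kj _ (sub_setD2 _ _ _) mc.
Qed.

End Faithful.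
End AGraph.

(** * Minimal size and Markov equivalence *)

Lemma maximal_completion_adj (V : finType) (G : mgraph V) (a b : V) : ancestral G ->
  adj G a b -> adj (maximal_completion G) a b.
Proof.
move=> /maximal_completionP[_ /fintype.subsetP sd /fintype.subsetP sb _].
by case/or3P => [/sd|/sd|/sb] h; rewrite /adj /dedge /bedge h ?orbT.
Qed.

Lemma maximal_completion_id_adj (V : finType) (G : mgraph V) (a b : V) : dmag G ->
  adj (maximal_completion G) a b -> adj G a b.
Proof.
case=> Ganc Gmax ab; have [[Hanc _] _ _ E] := maximal_completionP Ganc.
apply: contraT => nab; have neq := adj_neq ab.
have [S + []] := Gmax a b neq nab; rewrite sub_setC2 => /andP[aS bS].
exact: msep_model_m_connected E neq aS bS (adj_m_connected Hanc S ab).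
Qed.

Theorem theorem2 (d : measure_display) (T : measurableType d) (R : realType)
  (P : probability T R) (V : finType) (X : V -> {RV P >-> R})
  (Gstar : mgraph V) (tau : rel V) :
  dmag Gstar ->
  restricted_faithful X Gstar ->
  is_poset tau ->
  (forall pi : rel V, is_poset pi ->
    leq (gsize (Gpi X tau)) (gsize (Gpi X pi))) ->
  msep_model (Gpi X tau) = msep_model Gstar.
Proof.
move=> Gdmag Gfaith tauP tau_min; have [Ganc Gmax] := Gdmag.
have A'anc := AG_ancestral X tauP.
set A' := AG X tau in A'anc; set pi := po A'; set A := AG X pi.
have piP : is_poset pi by apply: po_poset.
have [_ pi_anti pi_trans] := piP.
have Aanc : ancestral A by apply: AG_ancestral.
have [[Hanc Hmax] _ _ HA] := maximal_completionP Aanc.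
have adjGA a b : adj Gstar a b -> adj A a b by apply: adj_AG_faithful.
have adjHG a b : adj (Gpi X tau) a b -> adj Gstar a b.
  apply: gsize_adj => // [i j ij|]; first by apply: maximal_completion_adj; rewrite // adjGA.
  (* The competitor is [po Gstar]: by [AG_po] its graph is the completion of [Gstar], which is
     maximal and gains no adjacency. *)
  apply: leq_trans (tau_min _ (po_poset Ganc)) _.
  rewrite /Gpi !AG_po //; apply: gsize_le => // [|i j]; last exact: maximal_completion_id_adj.
  by have [[]] := maximal_completionP Ganc.
have adjE a b : adj Gstar a b = adj A a b.
  by apply/idP/idP => [/adjGA//|ab]; apply/adjHG/maximal_completion_adj.
(* The completion of [A] gains no adjacency over [A], so its separating sets serve for [A]. *)
have Amax : maximal A.
  move=> a b ab nab; have [||S Sab nS] := Hmax a b => //.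
    by apply: contra nab => /adjHG; rewrite adjE.
  exists S => //; apply: contra_not nS; have := Sab; rewrite sub_setC2 => /andP[aS bS].
  exact: msep_model_m_connected (esym HA) ab aS bS.
have sep i k j : i != j -> ~~ adj Gstar i j -> adj Gstar i k -> adj Gstar k j ->
    ~ m_connected Gstar (pre pi i j :\: [set i; j]) i j.
  by rewrite adjE; apply: nadj_AG_separated.
(* If [a -> b] were missing in [A], the dependence behind it would m-connect [a] and [b] in [Gstar]
   given the rest of the [tau]-down-set of [b], which [down_set_separated] forbids. *)
have A'A a b : dedge A' a b -> dedge A a b.
  move=> ab'; have pab : pi a b by rewrite /pi poE connect1.
  rewrite dedge_AG_adj pab andbT -adjE; apply: contraT => nab; exfalso.
  move: ab'; rewrite dedge_AG => /and3P[ab tab /asboolP dep].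
  have [tau_refl _ tau_trans] := tauP.
  have pi_tau i j : pi i j -> tau i j by rewrite /pi poE; apply: connect_AG.
  pose W := [set x | tau x b]%SET.
  have preW : pre tau a b = W.
    by apply/setP => c; rewrite !inE orb_idl // => ca; apply: tau_trans tab.
  apply: (@down_set_separated V Gstar A pi Ganc Aanc adjE pi_anti pi_trans
    (dedge_AG_adj X pi) sep W a b) => //.
  - by rewrite inE.
  - by rewrite inE.
  - by move=> c k /pi_tau ck; rewrite !inE; apply: tau_trans.
  - move=> c; rewrite inE => cb; rewrite -/A dedge_AG_adj -/A -adjE => acb.
    rewrite acb /pi poE connect1 // dedge_AG_adj cb andbT.
    exact: (adj_AG_faithful Gfaith tau acb).
  - rewrite -preW; exact: (dependent_m_connected Gfaith ab (sub_setD2 _ _ _) dep).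
(* [A] contains the directed edges of [A'], and its own go up in [pi], so both graphs have the same
   ancestors. *)
have connectE i j : pi i j = connect (dedge A) i j.
  rewrite /pi poE; apply/idP/idP; last by move=> /(connect_AG piP); rewrite /pi poE.
  by apply: connect_sub => a b /A'A; apply: connect1.
have piE i j : pre pi i j = anc A [set i; j].
  by apply/setP => c; rewrite anc2 inE !connectE.
have sepA i j : i != j -> ~~ adj A i j -> ~ m_connected A (pre pi i j :\: [set i; j]) i j.
  by rewrite piE; apply: maximal_separated.
apply: etrans HA _; apply: msep_model_eq => x y Z xy _ _; split.
  have adjE' a b : adj A a b = adj Gstar a b by [].
  apply: (m_connected_transfer Aanc Amax Ganc adjE') xy => i k j ij nij ik kj.
  by exists (pre pi i j :\: [set i; j]); split; [apply: sepA|apply: (sep i k j); rewrite ?adjE].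
apply: (m_connected_transfer Ganc Gmax Aanc adjE) xy => i k j ij nij ik kj.
exists (pre pi i j :\: [set i; j]); split; first exact: (sep i k j).
by apply: sepA; rewrite // -adjE.
Qed.
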